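(* For every integer $s\ge 3$, the holomorphic action $\mathcal A_s: PSL(2,\mathbb C)\times\Omega^1(-1^s)\to\Omega^1(-1^s)$, $(T,\omega)\mapsto T_*\omega$, is proper; likewise the real analytic action of $PSL(2,\mathbb C)$ on $\mathcal{RI}\Omega^1(-s)$ given by $(T,\omega)\mapsto T_*\omega$ is proper.
   Context: $\Omega^1(-1^s)$ denotes the set of rational 1-forms on the Riemann sphere $\widehat{\mathbb C}$ having exactly $s$ poles, all simple (zeros are arbitrary). It is a $(2s-1)$-dimensional complex manifold via the bijection sending $\omega$ to the class $\langle r_1,\dots,r_s;p_1,\dots,p_s\rangle$ of its residues $r_\iota$ at its poles $p_\iota$ in $$\frac{H_s\times(\widehat{\mathbb C}^s\setminus\Delta)}{\mathcal S(s)},$$ where $H_s=\{(r_1,\dots,r_s)\in(\mathbb C^* )^s : \sum r_\iota=0\}$, $\widehat{\mathbb C}^s\setminus\Delta$ is the set of $s$-tuples of pairwise distinct points of $\widehat{\mathbb C}$, and the symmetric group $\mathcal S(s)$ acts by simultaneous permutation of the $r_\iota$ and the $p_\iota$. The group $PSL(2,\mathbb C)$ of Möbius transformations acts by push-forward; in these coordinates $T_*\langle r_1,\dots,r_s;p_1,\dots,p_s\rangle=\langle r_1,\dots,r_s;T(p_1),\dots,T(p_s)\rangle$. $\mathcal{RI}\Omega^1(-s)\subset\Omega^1(-1^s)$ is the real analytic submanifold of isochronous forms, i.e. those all of whose residues are purely imaginary. An action of $G$ on $M$ is proper if the map $G\times M\to M\times M$, $(g,x)\mapsto(g\cdot x,x)$,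 is proper. *)

(* Defs.v *)
From HB Require Import structures.
From mathcomp Require Import all_boot all_order all_algebra perm.
From mathcomp Require Import fraction complex ring.
From mathcomp Require Import all_classical all_reals topology normedtype.

Set Implicit Arguments.
Unset Strict Implicit.
Unset Printing Implicit Defensive.

Import Order.TTheory GRing.Theory Num.Theory.
Import numFieldNormedType.Exports.

Local Open Scope classical_set_scope.
Local Open Scope ring_scope.
Local Open Scope quotient_scope.

Local Notation "x %:F" := (@FracField.tofrac _ x).

Lemma polar_change_aux (F : fieldType) (r a c d x : F) :
  x != 0 -> a != 0 -> c * x + d != 0 ->
  r / (a * x / (c * x + d)) * (a * d / (c * x + d) ^+ 2) - r / x =
  - (r * c / (c * x + d)).
Proof. by move=> x0 a0 cd0; field; rewrite x0 a0 cd0. Qed.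

Lemma polar_inf_aux (F : fieldType) (c a x : F) :
  x != 0 -> 1 - a * x != 0 ->
  - (c / (x^-1 - a) / x ^+ 2) + c / x = - (c * a) / (1 - a * x).
Proof.
move=> x0 ax0; have E : x^-1 - a = (1 - a * x) / x by field.
by rewrite E; field; rewrite x0 ax0.
Qed.

Lemma inf_aux (F : fieldType) (u R x : F) : x != 0 ->
  - (u / x) = (- (u / x ^+ 2) - R / x) * x + R.
Proof. by move=> x0; field. Qed.

Section RationalForms.
(* To be instantiated with C = R[i] for R : realType; C carries the topology of
   its norm. *)
Variable C : numClosedFieldType.

Local Notation K := {fraction {poly C}}.

Definition sphere : Type := one_point_compactification C.
HB.instance Definition _ := Topological.copy sphere (one_point_compactification C).

(* f : rform stands for the rational 1-form f(z) dz on the sphere. *)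
Definition rform : Type := K.

Definition rconst (c : C) : K := c%:P%:F.

(* f o g; only meaningful when the denominator of f does not vanish at g,
   in particular whenever g is not constant. *)
Definition rcomp (f g : K) : K :=
  let x : {ratio {poly C}} := repr f in
  (map_poly rconst \n_x).[g] / (map_poly rconst \d_x).[g].

Definition mob_num (A : 'M[C]_2) : {poly C} := A 0 0 *: 'X + (A 0 1)%:P.
Definition mob_den (A : 'M[C]_2) : {poly C} := A 1 0 *: 'X + (A 1 1)%:P.

(* z |-> (A00 z + A01) / (A10 z + A11) as an element of C(z) *)
Definition mob_fun (A : 'M[C]_2) : K := (mob_num A)%:F / (mob_den A)%:F.

(* Pull-back of f(z) dz under S = mob_fun A, i.e. f(S(z)) S'(z) dz; here
   S'(z) = \det A / (A10 z + A11)^2. *)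
Definition mob_pullback (A : 'M[C]_2) (w : rform) : rform :=
  rcomp w (mob_fun A) * (rconst (\det A) / (mob_den A)%:F ^+ 2).

(* T_* w = (T^-1)^* w *)
Definition mob_pushforward (A : 'M[C]_2) (w : rform) : rform :=
  mob_pullback (invmx A) w.

Definition mx2 (a b c d : C) : 'M[C]_2 :=
  \matrix_(i, j) (if i == 0 then if j == 0 then a else b
                            else if j == 0 then c else d).

(* The inverse of the local coordinate t centred at p: t |-> t + a when p = a
   is finite, t |-> 1 / t when p is the point at infinity. *)
Definition chart (p : sphere) : 'M[C]_2 :=
  if p is Some a then mx2 1 a 0 1 else mx2 0 1 1 0.

(* w = (local_coef w p)(t) dt in the coordinate t centred at p *)
Definition local_coef (w : rform) (p : sphere) : K := mob_pullback (chart p) w.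

(* f has no pole at the origin *)
Definition regular0 (f : K) : Prop :=
  exists n d : {poly C}, d.[0] != 0 /\ f = n%:F / d%:F.

Definition poles (w : rform) : set sphere :=
  [set p | ~ regular0 (local_coef w p)].

(* w = (r / t + holomorphic) dt at p: p is at most a simple pole, with
   residue r. *)
Definition polar_part (w : rform) (p : sphere) (r : C) : Prop :=
  regular0 (local_coef w p - rconst r / 'X%:F).

Definition simple_pole (w : rform) (p : sphere) : Prop :=
  poles w p /\ exists r, polar_part w p r.

(* the residue of w at p, for p at most a simple pole of w *)
Definition residue (w : rform) (p : sphere) : C :=
  xget 0 [set r | polar_part w p r].

Definition is_Omega1 (s : nat) : set rform :=
  [set w | (poles w #= `I_s)%card /\ forall p, poles w p -> simple_pole w p].

Definition Omega1 (s : nat) : Type := set_type (is_Omega1 s).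

Lemma rconst_is_zmod_morphism : zmod_morphism rconst.
Proof. by move=> a b; rewrite /rconst !rmorphB. Qed.
HB.instance Definition _ :=
  GRing.isZmodMorphism.Build C K rconst rconst_is_zmod_morphism.

Lemma rconst_is_monoid_morphism : monoid_morphism rconst.
Proof. by split=> [|a b]; rewrite /rconst ?rmorph1 // !rmorphM. Qed.
HB.instance Definition _ :=
  GRing.isMonoidMorphism.Build C K rconst rconst_is_monoid_morphism.

Definition peval (g : K) (p : {poly C}) : K := (map_poly rconst p).[g].

Lemma pevalB g p q : peval g (p - q) = peval g p - peval g q.
Proof. by rewrite /peval rmorphB hornerD hornerN. Qed.
Lemma pevalD g p q : peval g (p + q) = peval g p + peval g q.
Proof. by rewrite /peval rmorphD hornerD. Qed.
Lemma pevalM g p q : peval g (p * q) = peval g p * peval g q.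
Proof. by rewrite /peval rmorphM hornerM. Qed.
Lemma pevalC g a : peval g a%:P = rconst a.
Proof. by rewrite /peval map_polyC hornerC. Qed.
Lemma pevalX g : peval g 'X = g.
Proof. by rewrite /peval map_polyX hornerX. Qed.

Lemma peval_id p : peval 'X%:F p = p%:F.
Proof.
elim/poly_ind: p => [|p c IH]; first by rewrite -polyC0 pevalC.
by rewrite pevalD pevalM IH pevalX pevalC rmorphD rmorphM.
Qed.

(* g is transcendental over the constants *)
Definition nonconst (g : K) := forall p, p != 0 -> peval g p != 0.

Lemma fracE (f : K) :
  f = (\n_(repr f : {ratio {poly C}}))%:F / (\d_(repr f : {ratio {poly C}}))%:F.
Proof.
set x : {ratio {poly C}} := repr f.
have d0 : (\d_x)%:F != 0 :> K by rewrite tofrac_eq0 denom_ratioP.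
apply: (mulIf d0); rewrite divfK // -[f in LHS]reprK -/x.
rewrite /FracField.tofrac; unlock.
rewrite -[LHS]FracField.pi_mul; apply/eqmodP => /=.
rewrite FracField.equivfE /FracField.mulf.
by rewrite !numden_Ratio ?mulf_neq0 ?denom_ratioP ?oner_neq0 // !mulr1 mulrC.
Qed.

Lemma fracP (f : K) : exists n d : {poly C}, d != 0 /\ f = n%:F / d%:F.
Proof.
exists \n_(repr f : {ratio {poly C}}), \d_(repr f : {ratio {poly C}}).
by split; [exact: denom_ratioP|exact: fracE].
Qed.

Lemma rcompE g n d : nonconst g -> d != 0 ->
  rcomp (n%:F / d%:F) g = peval g n / peval g d.
Proof.
move=> ng d0; rewrite /rcomp -!/(peval _ _).
have := fracE (n%:F / d%:F); set x : {ratio {poly C}} := repr _ => E.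
have x0 := denom_ratioP x; have F0 p : (p%:F == 0 :> K) = (p == 0).
  exact: tofrac_eq0.
have /eqP : n%:F / d%:F = (\n_x)%:F / (\d_x)%:F by [].
rewrite eqr_div ?F0 // -!tofracM tofrac_eq => /eqP nE.
apply/eqP; rewrite eqr_div ?ng //.
by rewrite -!pevalM nE.
Qed.

Section Rcomp.
Variables (g : K) (ng : nonconst g).

Lemma rcomp_poly p : rcomp p%:F g = peval g p.
Proof.
by rewrite -[p%:F]divr1 -tofrac1 rcompE ?oner_neq0 // -polyC1 pevalC rmorph1 divr1.
Qed.

Lemma rcompC c : rcomp (rconst c) g = rconst c.
Proof. by rewrite rcomp_poly pevalC. Qed.

Lemma rcompX : rcomp 'X%:F g = g.
Proof. by rewrite rcomp_poly pevalX. Qed.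

Lemma rcompD f1 f2 : rcomp (f1 + f2) g = rcomp f1 g + rcomp f2 g.
Proof.
have [n1 [d1 [d10 ->]]] := fracP f1; have [n2 [d2 [d20 ->]]] := fracP f2.
rewrite addf_div ?tofrac_eq0 // -!tofracM -tofracD !rcompE ?mulf_neq0 //.
by rewrite addf_div ?ng // pevalD !pevalM.
Qed.

Lemma rcompM f1 f2 : rcomp (f1 * f2) g = rcomp f1 g * rcomp f2 g.
Proof.
have [n1 [d1 [d10 ->]]] := fracP f1; have [n2 [d2 [d20 ->]]] := fracP f2.
by rewrite mulf_div -!tofracM !rcompE ?mulf_neq0 // mulf_div !pevalM.
Qed.

Lemma rcompV f : rcomp f^-1 g = (rcomp f g)^-1.
Proof.
have [n [d [d0 ->]]] := fracP f; have [->|n0] := eqVneq n 0.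
  by rewrite tofrac0 mul0r invr0 -tofrac0 rcomp_poly -polyC0 pevalC rmorph0 invr0.
by rewrite invf_div !rcompE // invf_div.
Qed.

Lemma rcompN f : rcomp (- f) g = - rcomp f g.
Proof. by rewrite -mulN1r rcompM -(rmorph1 rconst) -rmorphN rcompC rmorphN rmorph1 mulN1r. Qed.

Lemma rcompB f1 f2 : rcomp (f1 - f2) g = rcomp f1 g - rcomp f2 g.
Proof. by rewrite rcompD rcompN. Qed.

Lemma rcompE2 f n : rcomp (f ^+ n) g = rcomp f g ^+ n.
Proof.
elim: n => [|n IH]; last by rewrite !exprS rcompM IH.
by rewrite !expr0 -(rmorph1 rconst) rcompC.
Qed.

Lemma rcomp_peval h p : rcomp (peval h p) g = peval (rcomp h g) p.
Proof.
elim/poly_ind: p => [|p c IH]; first by rewrite -polyC0 !pevalC rcompC.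
by rewrite !pevalD !pevalM !pevalX !pevalC rcompD rcompM IH rcompC.
Qed.

Lemma rcompA f h : nonconst h -> rcomp (rcomp f h) g = rcomp f (rcomp h g).
Proof.
move=> nh; have [n [d [d0 ->]]] := fracP f.
have nhg : nonconst (rcomp h g).
  move=> p p0; rewrite -rcomp_peval; apply/eqP => E0.
  have /eqP := congr1 (rcomp^~ g) (mulfV (nh p p0)).
  by rewrite /= rcompM rcompV E0 mul0r -(rmorph1 rconst) rcompC rmorph1 eq_sym oner_eq0.
by rewrite rcompE // rcompM rcompV !rcomp_peval rcompE.
Qed.

End Rcomp.

Lemma rcomp_id f : rcomp f 'X%:F = f.
Proof.
have nX : nonconst 'X%:F by move=> p p0; rewrite peval_id tofrac_eq0.
by have [n [d [d0 ->]]] := fracP f; rewrite rcompE // !peval_id.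
Qed.

Lemma nonconstP g : (forall a, g != rconst a) -> nonconst g.
Proof.
move=> ga p p0; have [rs Ep] := closed_field_poly_normal p.
rewrite Ep -mul_polyC pevalM pevalC mulf_neq0 //.
  by rewrite /rconst tofrac_eq0 polyC_eq0 lead_coef_eq0.
elim: rs {Ep} => [|a rs IH].
  by rewrite big_nil -polyC1 pevalC rmorph1 oner_neq0.
rewrite big_cons pevalM; apply: mulf_neq0; last exact: IH.
by rewrite pevalB pevalX pevalC subr_eq0; exact: ga.
Qed.

Lemma det2 (A : 'M[C]_2) : \det A = A 0 0 * A 1 1 - A 0 1 * A 1 0.
Proof.
have l0 : lift 0 0 = 1 :> 'I_2 by exact/val_inj.
have l1 : lift 1 0 = 0 :> 'I_2 by exact/val_inj.
rewrite (expand_det_row _ 0) big_ord_recl big_ord1 /cofactor !det_mx11 !mxE /=.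
by rewrite !l0 l1 expr0 expr1 mul1r mulN1r mulrN.
Qed.

Lemma rconstE a : rconst a = a%:P%:F. Proof. by []. Qed.

Lemma mob_numE A : (mob_num A)%:F = rconst (A 0 0) * 'X%:F + rconst (A 0 1).
Proof. by rewrite /mob_num -mul_polyC rmorphD rmorphM. Qed.
Lemma mob_denE A : (mob_den A)%:F = rconst (A 1 0) * 'X%:F + rconst (A 1 1).
Proof. by rewrite /mob_den -mul_polyC rmorphD rmorphM. Qed.

Lemma mob_den_neq0 A : \det A != 0 -> mob_den A != 0.
Proof.
apply: contra => /eqP E; have := congr1 (fun p : {poly C} => p`_0) E.
have := congr1 (fun p : {poly C} => p`_1) E.
rewrite /mob_den !coefE /= mulr1 mulr0 addr0 add0r => c0 d0.
by rewrite det2 c0 d0 !mulr0 subr0.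
Qed.

Lemma mob_fun_nonconst A : \det A != 0 -> nonconst (mob_fun A).
Proof.
move=> dA; apply: nonconstP => a; apply/eqP => E.
have D0 : (mob_den A)%:F != 0 :> K by rewrite tofrac_eq0 mob_den_neq0.
have : (mob_num A)%:F = rconst a * (mob_den A)%:F.
  by rewrite -E /mob_fun divfK.
rewrite /rconst -tofracM => /eqP; rewrite tofrac_eq => /eqP E'.
have := congr1 (fun p : {poly C} => p`_0) E'; have := congr1 (fun p : {poly C} => p`_1) E'.
rewrite /mob_num /mob_den !coefCM !coefE /= !mulr1 !mulr0.
rewrite !addr0 !add0r => e1 e2.
by move: dA; rewrite det2 e1 e2 -!mulrA [A 1 0 * _]mulrC subrr eqxx.
Qed.

Lemma mxM2 (A B : 'M[C]_2) i j : (A *m B) i j = A i 0 * B 0 j + A i 1 * B 1 j.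
Proof.
rewrite mxE big_ord_recl big_ord1; congr (_ + A i _ * B _ j); exact/val_inj.
Qed.

Lemma mob_den_comp A B : \det B != 0 ->
  rcomp (mob_den A)%:F (mob_fun B) * (mob_den B)%:F = (mob_den (A *m B))%:F.
Proof.
move=> dB; have nB := mob_fun_nonconst dB.
have D0 : (mob_den B)%:F != 0 :> K by rewrite tofrac_eq0 mob_den_neq0.
rewrite mob_denE rcompD // rcompM // !rcompC // rcompX // mulrDl.
rewrite -mulrA /mob_fun divfK // mob_numE !mob_denE !mxM2 !rmorphD !rmorphM /=.
by ring.
Qed.

Lemma mob_num_comp A B : \det B != 0 ->
  rcomp (mob_num A)%:F (mob_fun B) * (mob_den B)%:F = (mob_num (A *m B))%:F.
Proof.
move=> dB; have nB := mob_fun_nonconst dB.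
have D0 : (mob_den B)%:F != 0 :> K by rewrite tofrac_eq0 mob_den_neq0.
rewrite mob_numE rcompD // rcompM // !rcompC // rcompX // mulrDl.
rewrite -mulrA /mob_fun divfK // !mob_numE !mob_denE !mxM2 !rmorphD !rmorphM /=.
by ring.
Qed.

Lemma mob_fun_comp A B : \det A != 0 -> \det B != 0 ->
  rcomp (mob_fun A) (mob_fun B) = mob_fun (A *m B).
Proof.
move=> dA dB; have nB := mob_fun_nonconst dB.
rewrite {1}/mob_fun rcompM // rcompV // /mob_fun -mob_num_comp // -mob_den_comp //.
by rewrite -[RHS]mulf_div divff ?mulr1 // tofrac_eq0 mob_den_neq0.
Qed.

Lemma mob_pullbackM A B w : \det A != 0 -> \det B != 0 ->
  mob_pullback (A *m B) w = mob_pullback B (mob_pullback A w).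
Proof.
move=> dA dB; have nB := mob_fun_nonconst dB; have nA := mob_fun_nonconst dA.
rewrite /mob_pullback rcompM // rcompM // rcompV // rcompE2 // rcompC //.
rewrite rcompA // mob_fun_comp // -mulrA; congr (_ * _).
by rewrite -mob_den_comp // exprMn invfM det_mulmx rmorphM /= mulrACA.
Qed.

Lemma mob_pullback1 w : mob_pullback 1%:M w = w.
Proof.
rewrite /mob_pullback /mob_fun /mob_num /mob_den !mxE /= det1.
rewrite scale1r scale0r add0r addr0 tofrac1 expr1n !divr1 rmorph1 mulr1.
exact: rcomp_id.
Qed.

Lemma mob_pullbackB A w1 w2 : \det A != 0 ->
  mob_pullback A (w1 - w2) = mob_pullback A w1 - mob_pullback A w2.
Proof.
by move=> dA; rewrite /mob_pullback rcompB ?mulrBl //; exact: mob_fun_nonconst.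
Qed.

Lemma det_chart p : \det (chart p) != 0.
Proof.
case: p => [a|]; rewrite det2 !mxE /= ?mulr0 ?mulr1 ?subr0 ?sub0r ?mul0r ?oppr_eq0.
  exact: oner_neq0.
exact: oner_neq0.
Qed.

Lemma mob_pullbackK A w : \det A != 0 ->
  mob_pullback (invmx A) (mob_pullback A w) = w.
Proof.
move=> dA; have uA : A \in unitmx by rewrite unitmxE unitfE.
have dV : \det (invmx A) != 0 by rewrite det_inv invr_eq0.
by rewrite -mob_pullbackM // mulmxV // mob_pullback1.
Qed.

(* f is regular at 0 with value v *)
Definition regval (f : K) (v : C) : Prop :=
  exists n d : {poly C}, [/\ d.[0] != 0, f = n%:F / d%:F & v = n.[0] / d.[0]].

Lemma regvalP f : regular0 f <-> exists v, regval f v.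
Proof.
split=> [[n [d [d0 ->]]]|[v [n [d [d0 -> _]]]]]; last by exists n, d.
by exists (n.[0] / d.[0]), n, d.
Qed.

Lemma regval_regular f v : regval f v -> regular0 f.
Proof. by move=> fv; apply/regvalP; exists v. Qed.

Lemma regval_poly p : regval p%:F p.[0].
Proof. by exists p, 1; rewrite !hornerC tofrac1 !divr1 oner_neq0. Qed.

Lemma regvalC c : regval (rconst c) c.
Proof. by rewrite -[X in regval _ X](hornerC c 0); exact: regval_poly. Qed.

Let root0 (d : {poly C}) : d.[0] != 0 -> d%:F != 0 :> K.
Proof. by rewrite tofrac_eq0; apply: contra => /eqP ->; rewrite horner0. Qed.

Lemma regvalD f g u v : regval f u -> regval g v -> regval (f + g) (u + v).
Proof.
move=> [n [d [d0 -> ->]]] [m [e [e0 -> ->]]].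
exists (n * e + m * d), (d * e); rewrite !hornerD !hornerM mulf_neq0 //.
by rewrite !addf_div ?root0 // tofracD !tofracM.
Qed.

Lemma regvalM f g u v : regval f u -> regval g v -> regval (f * g) (u * v).
Proof.
move=> [n [d [d0 -> ->]]] [m [e [e0 -> ->]]].
exists (n * m), (d * e); rewrite !hornerM mulf_neq0 //.
by rewrite !mulf_div !tofracM.
Qed.

Lemma regvalV f u : u != 0 -> regval f u -> regval f^-1 u^-1.
Proof.
move=> u0 [n [d [d0 -> E]]]; exists d, n; rewrite E !invf_div; split=> //.
by apply: contra u0 => /eqP n0; rewrite E n0 mul0r.
Qed.

Lemma regval_uniq f u v : regval f u -> regval f v -> u = v.
Proof.
move=> [n [d [d0 -> ->]]] [m [e [e0 /eqP + ->]]].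
rewrite eqr_div ?root0 // -!tofracM tofrac_eq => /eqP nE.
by apply/eqP; rewrite eqr_div // -!hornerM nE.
Qed.

Lemma regval_peval g v p : regval g v -> regval (peval g p) p.[v].
Proof.
move=> gv; elim/poly_ind: p => [|p c IH].
  by rewrite -polyC0 pevalC hornerC; exact: regvalC.
rewrite pevalD pevalM pevalX pevalC hornerMXaddC.
by apply: regvalD (regvalC _); exact: regvalM.
Qed.

Lemma regular0D f g : regular0 f -> regular0 g -> regular0 (f + g).
Proof.
by move=> /regvalP[u fu] /regvalP[v gv]; exact: regval_regular (regvalD fu gv).
Qed.

Lemma regular0M f g : regular0 f -> regular0 g -> regular0 (f * g).
Proof.
by move=> /regvalP[u fu] /regvalP[v gv]; exact: regval_regular (regvalM fu gv).
Qed.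

Lemma regular0C c : regular0 (rconst c).
Proof. exact: regval_regular (regvalC c). Qed.

Lemma regular0N f : regular0 f -> regular0 (- f).
Proof.
move=> f0; rewrite -mulN1r -(rmorph1 rconst) -rmorphN.
by apply: regular0M => //; exact: regular0C.
Qed.

Lemma regular0_poly p : regular0 p%:F.
Proof. exact: regval_regular (regval_poly p). Qed.

Lemma regular0_sum (I : Type) (r : seq I) (P : pred I) (F : I -> K) :
  (forall i, P i -> regular0 (F i)) -> regular0 (\sum_(i <- r | P i) F i).
Proof.
move=> F0; apply: big_ind => //; last exact: regular0D.
by rewrite -(rmorph0 rconst); exact: regular0C.
Qed.

Let fX0 : 'X%:F != 0 :> K. Proof. by rewrite tofrac_eq0 polyX_eq0. Qed.

Lemma regular0_simple (c : C) : regular0 (rconst c / 'X%:F) -> c = 0.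
Proof.
move=> /regvalP[v cv]; apply: (@regval_uniq (rconst c)); first exact: regvalC.
rewrite -[rconst c](divfK fX0) -[0](mulr0 v); apply: regvalM => //.
by rewrite -[X in regval _ X](hornerX 0); exact: regval_poly.
Qed.

Lemma polar_part0 w p : polar_part w p 0 <-> regular0 (local_coef w p).
Proof. by rewrite /polar_part rmorph0 mul0r subr0. Qed.

Lemma polar_part_uniq w p : is_subset1 [set r | polar_part w p r].
Proof.
move=> r1 r2 /= h1 h2; apply/eqP; rewrite -subr_eq0; apply/eqP.
apply: regular0_simple; rewrite rmorphB mulrBl.
suff <- : (local_coef w p - rconst r2 / 'X%:F) -
  (local_coef w p - rconst r1 / 'X%:F) = rconst r1 / 'X%:F - rconst r2 / 'X%:F.
  by apply: regular0D => //; exact: regular0N.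
by rewrite opprB addrC addrA subrK.
Qed.

Lemma residueE w p r : polar_part w p r -> residue w p = r.
Proof.
by move=> wr; rewrite /residue; apply: xget_subset1 => //; exact: polar_part_uniq.
Qed.

(* coordinate changes fixing the origin preserve polar parts *)
Lemma polar_change (B : 'M[C]_2) (h : K) r : \det B != 0 -> B 0 1 = 0 ->
  regular0 (h - rconst r / 'X%:F) ->
  regular0 (mob_pullback B h - rconst r / 'X%:F).
Proof.
move=> dB B01; have nB := mob_fun_nonconst dB.
move: (dB); rewrite det2 B01 mul0r subr0 mulf_eq0 negb_or => /andP[a0 d0].
have den0 : (mob_den B).[0] = B 1 1 by rewrite /mob_den !hornerE.
have g0 : regval (mob_fun B) 0.
  exists (mob_num B), (mob_den B); by rewrite den0; split=> //; rewrite /mob_num !hornerE B01 mul0r.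
have Dv : regval (mob_den B)%:F^-1 (B 1 1)^-1.
  by apply: regvalV => //; rewrite -den0; exact: regval_poly.
have D0 : (mob_den B)%:F != 0 :> K by rewrite tofrac_eq0 mob_den_neq0.
set u := h - _ => u0.
have -> : h = u + rconst r / 'X%:F by rewrite subrK.
set J := rconst (\det B) / (mob_den B)%:F ^+ 2.
have J0 : regular0 J.
  rewrite /J -exprVn expr2; apply: regular0M; first exact: regular0C.
  by apply: regular0M; exact: regval_regular Dv.
have -> : mob_pullback B (u + rconst r / 'X%:F) - rconst r / 'X%:F =
   rcomp u (mob_fun B) * J - rconst (r * B 1 0) / (mob_den B)%:F.
  rewrite /mob_pullback -/J rcompD // rcompM // rcompV // rcompC // rcompX //.
  rewrite mulrDl -addrA; congr (_ + _).
  have a0' : rconst (B 0 0) != 0 by rewrite /rconst tofrac_eq0 polyC_eq0.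
  have mn : (mob_num B)%:F = rconst (B 0 0) * 'X%:F.
    by rewrite mob_numE B01 rmorph0 addr0.
  rewrite /J /mob_fun mn det2 B01 mul0r subr0 !rmorphM /=.
  move: D0; rewrite mob_denE => D0.
  exact: (@polar_change_aux K (rconst r) _ _ _ _ fX0 a0' D0).
apply: regular0D; last first.
  apply: regular0N; apply: regular0M; first exact: regular0C.
  exact: regval_regular Dv.
apply: regular0M => //; case: u0 => n [d [dn0 ->]].
have d_neq0 : d != 0 by rewrite -(tofrac_eq0 d) root0.
rewrite rcompE //; apply: regular0M; first exact: regval_regular (regval_peval _ g0).
by apply: regval_regular (regvalV dn0 (regval_peval _ g0)).
Qed.

(* The Moebius action on the sphere, through homogeneous coordinates: the
   second column of chart p is a homogeneous coordinate vector of p. *)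
Definition hvec (p : sphere) : 'cV[C]_2 := col 1 (chart p).

Definition of_hvec (v : 'cV[C]_2) : sphere :=
  if v 1 0 == 0 then None else Some (v 0 0 / v 1 0).

Definition moebius (A : 'M[C]_2) (p : sphere) : sphere := of_hvec (A *m hvec p).

Lemma moebiusE A p : moebius A p =
  if p is Some a then
    if A 1 0 * a + A 1 1 == 0 then None
    else Some ((A 0 0 * a + A 0 1) / (A 1 0 * a + A 1 1))
  else if A 1 0 == 0 then None else Some (A 0 0 / A 1 0).
Proof.
have sum2 i (v : 'cV[C]_2) : (A *m v) i 0 = A i 0 * v 0 0 + A i 1 * v 1 0.
  rewrite mxE big_ord_recl big_ord1; congr (_ + A i _ * v _ 0); exact/val_inj.
rewrite /moebius /of_hvec !sum2 /hvec.
by case: p => [a|]; rewrite !mxE /= ?mulr1 ?mulr0 ?addr0.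
Qed.

Lemma of_hvecZ c v : c != 0 -> of_hvec (c *: v) = of_hvec v.
Proof.
move=> c0; rewrite /of_hvec !mxE mulf_eq0 (negPf c0) /=; case: ifPn => // v0.
by congr Some; rewrite -mulf_div divff // mul1r.
Qed.

Lemma cV2P (v w : 'cV[C]_2) : v 0 0 = w 0 0 -> v 1 0 = w 1 0 -> v = w.
Proof.
move=> e0 e1; apply/matrixP => i j; rewrite ord1.
case: i => -[|[|//]] lti.
  by rewrite (_ : Ordinal lti = 0) //; exact/val_inj.
by rewrite (_ : Ordinal lti = 1) //; exact/val_inj.
Qed.

Lemma of_hvecK v : v != 0 -> exists2 c, c != 0 & v = c *: hvec (of_hvec v).
Proof.
move=> v0; rewrite /of_hvec; case: ifPn => [/eqP v10|v10].
  have v00 : v 0 0 != 0.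
    by apply: contra v0 => /eqP v00; apply/eqP/cV2P; rewrite !mxE.
  by exists (v 0 0) => //; apply: cV2P; rewrite !mxE /= ?mulr1 ?mulr0.
exists (v 1 0) => //; apply: cV2P; rewrite !mxE /= ?mulr1 //.
by rewrite mulrC divfK.
Qed.

Lemma hvec_neq0 p : hvec p != 0.
Proof.
apply/eqP => /matrixP E; case: p E => [a|] E.
  by have /eqP := E 1 0; rewrite !mxE /= oner_eq0.
by have /eqP := E 0 0; rewrite !mxE /= oner_eq0.
Qed.

Lemma moebius1 p : moebius 1%:M p = p.
Proof.
rewrite moebiusE !mxE /=; case: p => [a|]; last by rewrite eqxx.
by rewrite mul0r add0r oner_eq0 mul1r addr0 divr1.
Qed.

Lemma moebiusM A B p : \det B != 0 ->
  moebius (A *m B) p = moebius A (moebius B p).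
Proof.
move=> dB; have Bp0 : B *m hvec p != 0.
  apply: contra (hvec_neq0 p) => /eqP Bp.
  have uB : B \in unitmx by rewrite unitmxE unitfE.
  by rewrite -(mulKmx uB (hvec p)) Bp mulmx0.
have [c c0 E] := of_hvecK Bp0.
by rewrite /moebius -mulmxA {1}E -scalemxAr of_hvecZ.
Qed.

Lemma moebiusK A : \det A != 0 -> cancel (moebius A) (moebius (invmx A)).
Proof.
move=> dA p; have uA : A \in unitmx by rewrite unitmxE unitfE.
by rewrite -moebiusM // mulVmx // moebius1.
Qed.

Lemma moebiusVK A : \det A != 0 -> cancel (moebius (invmx A)) (moebius A).
Proof.
move=> dA p; have uA : A \in unitmx by rewrite unitmxE unitfE.
by rewrite -moebiusM ?det_inv ?invr_eq0 // mulmxV // moebius1.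
Qed.

Lemma chart_moebius A p : \det A != 0 -> exists B : 'M[C]_2,
  [/\ \det B != 0, B 0 1 = 0 & A *m chart p = chart (moebius A p) *m B].
Proof.
move=> dA; set q := moebius A p.
have uq : chart q \in unitmx by rewrite unitmxE unitfE det_chart.
pose M := A *m chart p; exists (invmx (chart q) *m M).
rewrite mulKVmx // !det_mulmx !mulf_neq0 ?det_chart //; last first.
  by rewrite det_inv invr_eq0 det_chart.
split=> //; have [c _ E] : exists2 c, c != 0 & A *m hvec p = c *: hvec q.
  apply: of_hvecK; apply: contra (hvec_neq0 p) => /eqP Ap.
  have uA : A \in unitmx by rewrite unitmxE unitfE.
  by rewrite -(mulKmx uA (hvec p)) Ap mulmx0.
have -> (N : 'M[C]_2) : N 0 1 = (col 1 N : 'cV[C]_2) 0 0 by rewrite mxE.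
rewrite colE -mulmxA -[M *m _]mulmxA -colE -/(hvec p) E -scalemxAr /hvec.
by rewrite [col 1 (chart q)]colE mulKmx // !mxE /= mulr0.
Qed.

Lemma polar_part_pullback A w p r : \det A != 0 ->
  polar_part w (moebius A p) r <-> polar_part (mob_pullback A w) p r.
Proof.
move=> dA; have [B [dB B01 E]] := chart_moebius p dA.
have loc : local_coef (mob_pullback A w) p =
    mob_pullback B (local_coef w (moebius A p)).
  by rewrite /local_coef -!mob_pullbackM ?det_chart // E.
split; rewrite /polar_part loc; first exact: polar_change.
have uB : B \in unitmx by rewrite unitmxE unitfE.
have dV : \det (invmx B) != 0 by rewrite det_inv invr_eq0.
have BV01 : invmx B 0 1 = 0.
  have := congr1 (fun N : 'M[C]_2 => N 0 1) (mulmxV uB).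
  rewrite mxM2 B01 mul0r addr0 !mxE /= => /eqP; rewrite mulf_eq0 => /orP[|/eqP//].
  by move: dB; rewrite det2 B01 mul0r subr0 mulf_eq0 negb_or => /andP[/negPf->].
by move=> /(polar_change dV BV01); rewrite mob_pullbackK.
Qed.

Lemma poles_pullback A w p : \det A != 0 ->
  poles w (moebius A p) <-> poles (mob_pullback A w) p.
Proof.
move=> dA; rewrite /poles /= -!polar_part0 (polar_part_pullback _ _ _ dA).
by [].
Qed.

Lemma residue_pullback A w p : \det A != 0 ->
  residue w (moebius A p) = residue (mob_pullback A w) p.
Proof.
move=> dA; congr xget; apply/seteqP; split=> r /=;
  by rewrite (polar_part_pullback _ _ _ dA).
Qed.

Lemma is_Omega1_pullback A s w : \det A != 0 ->
  is_Omega1 s w -> is_Omega1 s (mob_pullback A w).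
Proof.
move=> dA [cw sw]; split.
  suff -> : poles (mob_pullback A w) = moebius (invmx A) @` poles w.
    apply: card_eq_trans cw; apply: inj_card_eq => p q _ _.
    exact: (can_inj (moebiusVK dA)).
  apply/seteqP; split=> p /=.
    move=> /(proj2 (poles_pullback w p dA)) wp; exists (moebius A p) => //.
    exact: moebiusK.
  by move=> [q wq <-]; apply: (proj1 (poles_pullback w _ dA)); rewrite moebiusVK.
move=> p wp; split=> //; have [_ [r wr]] := sw _ (proj2 (poles_pullback w p dA) wp).
by exists r; apply: (proj1 (polar_part_pullback w p r dA)).
Qed.

Lemma polar_partB w1 w2 p r1 r2 :
  polar_part w1 p r1 -> polar_part w2 p r2 ->
  polar_part ((w1 : K) - w2) p (r1 - r2).
Proof.
rewrite /polar_part /local_coef mob_pullbackB ?det_chart // => h1 h2.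
rewrite rmorphB mulrBl.
set x1 := mob_pullback _ w1 in h1 *; set x2 := mob_pullback _ w2 in h2 *.
have -> : x1 - x2 - (rconst r1 / 'X%:F - rconst r2 / 'X%:F) =
    (x1 - rconst r1 / 'X%:F) - (x2 - rconst r2 / 'X%:F).
  by rewrite !opprB addrACA [RHS]addrACA [- x2 + _]addrC.
by apply: regular0D => //; exact: regular0N.
Qed.

Lemma polar_part_zero p : polar_part (0 : K) p 0.
Proof.
apply/polar_part0; rewrite /local_coef -(subrr (0 : K)) mob_pullbackB ?det_chart //.
by rewrite subrr -(rmorph0 rconst); exact: regular0C.
Qed.

Lemma polar_part_sum (I : Type) (l : seq I) (P : pred I) (F : I -> K) p (r : I -> C) :
  (forall i, P i -> polar_part (F i) p (r i)) ->
  polar_part (\sum_(i <- l | P i) F i) p (\sum_(i <- l | P i) r i).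
Proof.
move=> Fr; apply: (big_ind2 (fun f c => polar_part f p c)) => //.
  exact: polar_part_zero.
move=> f1 c1 f2 c2 h1 h2; rewrite -[f2]opprK -[c2]opprK.
apply: polar_partB => //; rewrite -(sub0r f2) -(sub0r c2).
exact: polar_partB (polar_part_zero p) h2.
Qed.

Lemma peval_comp (q p : {poly C}) : peval q%:F p = (p \Po q)%:F.
Proof.
elim/poly_ind: p => [|p c IH]; first by rewrite comp_poly0 -polyC0 pevalC.
rewrite comp_polyD comp_polyM comp_polyX comp_polyC pevalD pevalM pevalX pevalC.
by rewrite IH rmorphD rmorphM.
Qed.

Lemma mob_fun_fin a : mob_fun (chart (Some a)) = ('X + a%:P)%:F.
Proof.
rewrite /mob_fun /mob_num /mob_den !mxE /= scale1r scale0r add0r.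
by rewrite polyC1 tofrac1 divr1.
Qed.

Lemma local_fin (f : K) a :
  local_coef f (Some a) = rcomp f ('X + a%:P)%:F.
Proof.
rewrite /local_coef /mob_pullback mob_fun_fin /mob_den det2 !mxE /=.
rewrite scale0r add0r polyC1 tofrac1 expr1n divr1 mulr0 subr0 mulr1 rmorph1.
by rewrite mulr1.
Qed.

Lemma local_inf (f : K) :
  local_coef f None = - (rcomp f ('X%:F)^-1 / 'X%:F ^+ 2).
Proof.
rewrite /local_coef /mob_pullback /mob_fun /mob_num /mob_den det2 !mxE /=.
rewrite !scale0r !scale1r add0r addr0 polyC1 tofrac1 mul0r sub0r mulr1 div1r.
by rewrite rmorphN rmorph1 mulN1r mulrN.
Qed.

Lemma nonconst_fin a : nonconst ('X + a%:P)%:F.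
Proof. by rewrite -mob_fun_fin; apply: mob_fun_nonconst; exact: det_chart. Qed.

Lemma nonconst_inf : nonconst ('X%:F)^-1.
Proof.
have : nonconst (mob_fun (chart None)) by apply: mob_fun_nonconst; exact: det_chart.
rewrite /mob_fun /mob_num /mob_den !mxE /=.
by rewrite !scale0r !scale1r add0r addr0 polyC1 tofrac1 div1r.
Qed.

Definition simple_fraction (a c : C) : K := rconst c / ('X - a%:P)%:F.

Lemma polar_part_simple_fin a b c :
  polar_part (simple_fraction a c) (Some b) (if a == b then c else 0).
Proof.
have nb := nonconst_fin b.
have E : local_coef (simple_fraction a c) (Some b) =
    rconst c / ('X + (b - a)%:P)%:F.
  rewrite local_fin rcompM // rcompC // rcompV // rcomp_poly // peval_comp.
  by rewrite comp_polyB comp_polyX comp_polyC polyCB addrA.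
rewrite /polar_part E; case: eqVneq => [->|ab].
  rewrite subrr addr0 subrr -(rmorph0 rconst); exact: regular0C.
rewrite rmorph0 mul0r subr0; exists c%:P, ('X + (b - a)%:P); split=> //.
by rewrite !hornerE subr_eq0 eq_sym.
Qed.

Lemma polar_part_simple_inf a c : polar_part (simple_fraction a c) None (- c).
Proof.
have nX := nonconst_inf.
have D0 : (1 - a *: 'X : {poly C}).[0] != 0.
  by rewrite !hornerE ?mulr0 ?subr0 ?oner_neq0.
have D0' := root0 D0.
rewrite /polar_part local_inf /simple_fraction rcompM // rcompC // rcompV //.
rewrite rcomp_poly // pevalB pevalX pevalC rmorphN mulNr opprK.
exists (- (c * a))%:P, (1 - a *: 'X); split=> //.
move: D0'; rewrite -mul_polyC !(rmorphB, rmorphN, rmorphM, rmorph1) /=.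
rewrite -!rconstE => D0'; exact: (@polar_inf_aux K _ _ _ fX0 D0').
Qed.

Lemma poly_of_regular (g : K) :
  (forall a, regular0 (local_coef g (Some a))) -> exists P, g = P%:F.
Proof.
move=> gr; have [n [d [d0 Eg]]] := fracP g.
pose h := gcdp n d; pose N := n %/ h; pose D := d %/ h.
have h0 : h != 0 by rewrite gcdp_eq0 negb_and d0 orbT.
have En : n = N * h by rewrite divpK // dvdp_gcdl.
have Ed : d = D * h by rewrite divpK // dvdp_gcdr.
have D0 : D != 0 by apply: contraNneq d0 => D0; rewrite Ed D0 mul0r.
have cop : coprimep N D by apply: coprimep_div_gcd; rewrite d0 orbT.
have {}Eg : g = N%:F / D%:F.
  rewrite Eg En Ed !tofracM -[LHS]mulf_div.
  have hF : h%:F != 0 :> K by rewrite tofrac_eq0.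
  by rewrite (divff hF) mulr1.
have [/eqP/size_poly1P[c c0 Dc]|sD] := eqVneq (size D) 1%N.
  exists (c^-1 *: N); rewrite Eg Dc.
  have cF : c%:P%:F != 0 :> K by rewrite tofrac_eq0 polyC_eq0.
  apply: (mulIf cF); rewrite divfK // -tofracM -mul_polyC mulrAC -polyCM.
  by rewrite mulVf // mul1r.
have [a rDa] : exists a, root D a by exact/closed_rootP.
have := gr a; rewrite local_fin Eg (@rcompE _ N D (@nonconst_fin a) D0).
rewrite !peval_comp => -[m [e [e0 /eqP]]].
have Da0 : (D \Po ('X + a%:P))%:F != 0 :> K.
  by rewrite -peval_comp; apply: nonconst_fin.
rewrite (eqr_div _ _ Da0 (root0 e0)) -!tofracM tofrac_eq.
move=> /eqP /(congr1 (fun q : {poly C} => q.[0])).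
rewrite !hornerM !horner_comp !hornerE (rootP rDa) mulr0 => /eqP.
rewrite mulf_eq0 (negPf e0) orbF => /eqP Na.
by have := coprimep_root cop (introT eqP Na); rewrite (rootP rDa) eqxx.
Qed.

Lemma regular_inf_const (P : {poly C}) :
  regular0 (peval ('X%:F)^-1 P) -> exists c, P = c%:P.
Proof.
elim/poly_ind: P => [|P c IH]; first by exists 0.
rewrite pevalD pevalM pevalX pevalC => reg.
have regP : regular0 (peval ('X%:F)^-1 P / 'X%:F).
  rewrite -[X in regular0 X](addrK (rconst c)); apply: regular0D => //.
  by apply: regular0N; exact: regular0C.
have [k Pk] : exists k, P = k%:P.
  apply: IH; rewrite -[X in regular0 X](divfK fX0); apply: regular0M => //.
  exact: regular0_poly.
move: regP; rewrite Pk pevalC => /regular0_simple ->.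
by exists c; rewrite mul0r add0r.
Qed.

Lemma residue_theorem s (w : rform) (p : 'I_s -> sphere) (r : 'I_s -> C) :
  injective p -> range p = poles w ->
  (forall i, polar_part w (p i) (r i)) -> \sum_i r i = 0.
Proof.
move=> injp rp wr.
have wq q : polar_part w q (\sum_(i | p i == q) r i).
  have [[i /eqP pi]|np] := pselect (exists i, p i = q).
    rewrite (bigD1 i) //= big1 ?addr0; first by rewrite -(eqP pi).
    by move=> j /andP[/eqP pj /eqP]; case; apply: injp; rewrite pj (eqP pi).
  rewrite big_pred0 => [|i]; last by apply/eqP => pi; apply: np; exists i.
  apply/polar_part0; apply: contrapT => wpole.
  have : range p q by rewrite rp.
  by case=> i _ pi; apply: np; exists i.
pose F i : K := if p i is Some a then simple_fraction a (r i) else 0.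
pose g : K := (w : K) - \sum_i F i.
have gfin a : regular0 (local_coef g (Some a)).
  apply/polar_part0; rewrite -(subrr (\sum_(i | p i == Some a) r i)).
  apply: polar_partB => //; rewrite [X in polar_part _ _ X]big_mkcond.
  apply: polar_part_sum => i _; rewrite /F.
  case: (p i) => [b|]; first exact: polar_part_simple_fin.
  exact: polar_part_zero.
have ginf : polar_part g None (\sum_i r i).
  have -> : \sum_i r i = \sum_(i | p i == None) r i -
      \sum_i (if p i == None then 0 else - r i).
    rewrite [X in _ = X - _]big_mkcond -sumrB; apply: eq_bigr => i _.
    by case: ifP; rewrite ?subr0 // sub0r opprK.
  apply: polar_partB => //; apply: polar_part_sum => i _; rewrite /F.
  case: (p i) => [b|]; first exact: polar_part_simple_inf.
  exact: polar_part_zero.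
have [P gP] := poly_of_regular gfin.
have nX := nonconst_inf.
move: ginf; rewrite /polar_part local_inf gP rcomp_poly //.
set R := \sum_i r i => reg.
have regX : regular0 (- (peval ('X%:F)^-1 P / 'X%:F)).
  have -> : - (peval ('X%:F)^-1 P / 'X%:F) =
    (- (peval ('X%:F)^-1 P / 'X%:F ^+ 2) - rconst R / 'X%:F) * 'X%:F + rconst R.
    exact: (@inf_aux K _ _ _ fX0).
  apply: regular0D; last exact: regular0C.
  by apply: regular0M => //; exact: regular0_poly.
have [c Pc] : exists c, P = c%:P.
  apply: regular_inf_const.
  rewrite -[X in regular0 X](divfK fX0); apply: regular0M.
    by rewrite -[X in regular0 X]opprK; exact: regular0N.
  exact: regular0_poly.
have c0 : c = 0.
  apply: regular0_simple; rewrite -[X in regular0 X]opprK.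
  by apply: regular0N; rewrite Pc pevalC in regX.
move: reg; rewrite Pc c0 pevalC rmorph0 mul0r oppr0 sub0r => /regular0N.
by rewrite opprK; exact: regular0_simple.
Qed.

(* H_s x (sphere^s minus the fat diagonal) *)
Definition residue_data (s : nat) : set ('rV[C]_s * 'rV[sphere]_s) :=
  [set x : 'rV[C]_s * 'rV[sphere]_s |
    [/\ forall i, x.1 0 i != 0, \sum_i x.1 0 i = 0 & injective (x.2 0)]].
Arguments residue_data : clear implicits.

Section Coordinates.
Variable s : nat.

Definition perm_eqv (x y : residue_data s) : bool :=
  [exists t : 'S_s, ((val y).1 == col_perm t (val x).1) &&
                    ((val y).2 == col_perm t (val x).2)].

Lemma perm_eqv_refl : reflexive perm_eqv.
Proof. by move=> x; apply/existsP; exists 1%g; rewrite !col_perm1 !eqxx. Qed.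

Lemma perm_eqv_sym : symmetric perm_eqv.
Proof.
have sym x y : perm_eqv x y -> perm_eqv y x.
  move=> /existsP[t /andP[/eqP E1 /eqP E2]]; apply/existsP; exists (t^-1)%g.
  by rewrite E1 E2 -!col_permM mulVg !col_perm1 !eqxx.
by move=> x y; apply/idP/idP; exact: sym.
Qed.

Lemma perm_eqv_trans : transitive perm_eqv.
Proof.
move=> y x z /existsP[t /andP[/eqP E1 /eqP E2]] /existsP[u /andP[/eqP F1 /eqP F2]].
by apply/existsP; exists (u * t)%g; rewrite F1 F2 E1 E2 -!col_permM !eqxx.
Qed.

Canonical perm_eqv_equiv :=
  EquivRel perm_eqv perm_eqv_refl perm_eqv_sym perm_eqv_trans.

(* (H_s x (sphere^s minus the fat diagonal)) / S(s) *)
Definition residue_space : Type := quotient_topology {eq_quot perm_eqv}.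
HB.instance Definition _ :=
  Topological.copy residue_space (quotient_topology {eq_quot perm_eqv}).

Definition residue_class (x : residue_data s) : residue_space :=
  \pi_(quotient_topology {eq_quot perm_eqv})%qT x.

Definition lists_residues (w : rform) (x : residue_data s) : Prop :=
  range ((val x).2 0) = poles w /\
  forall i, (val x).1 0 i = residue w ((val x).2 0 i).

Lemma lists_residues_exists (w : Omega1 s) :
  exists x : residue_data s, lists_residues (val w) x.
Proof.
case: w => w /= /set_mem[/card_esym/card_set_bijP[f [f1 f2 f3]] sw].
pose p := (\row_(i < s) f i : 'rV[sphere]_s).
have pE (i : 'I_s) : p 0 i = f i by rewrite mxE.
have injp : injective (p 0).
  move=> i j; rewrite !pE => /f2 E; apply/val_inj/E; apply/mem_set => /=;
    exact: ltn_ord.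
have rp : range (p 0) = poles w.
  apply/seteqP; split=> q /=; first by move=> [i _ <-]; rewrite pE; apply: f1 => /=.
  by move=> /f3[i /= si <-]; exists (Ordinal si) => //; rewrite pE.
have polar i : polar_part w (p 0 i) (residue w (p 0 i)).
  have [_ [r wr]] : simple_pole w (p 0 i) by apply: sw; rewrite -rp; exists i.
  by rewrite (residueE wr).
pose r := (\row_(i < s) residue w (p 0 i) : 'rV[C]_s).
have rE i : r 0 i = residue w (p 0 i) by rewrite mxE.
have dat : residue_data s (r, p).
  split=> //=.
    move=> i; rewrite rE; apply/eqP => r0.
    have [] : poles w (p 0 i) by rewrite -rp; exists i.
    by apply/polar_part0; rewrite -r0.
  by apply: (residue_theorem injp rp) => i; rewrite rE.
by exists (exist _ (r, p) (mem_set dat)); split.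
Qed.

(* w |-> <r_1, ..., r_s; p_1, ..., p_s> *)
Definition residue_coords (w : Omega1 s) : residue_space :=
  residue_class (sval (cid (lists_residues_exists w))).

Lemma residue_coordsE (w : Omega1 s) (x : residue_data s) :
  lists_residues (val w) x -> residue_coords w = residue_class x.
Proof.
rewrite /residue_coords; case: cid => /= y [ry ey] [rx ex].
apply/eqmodP => /=; apply/existsP.
have injy := let: And3 _ _ h := set_mem (valP y) in h.
have injx := let: And3 _ _ h := set_mem (valP x) in h.
have ex_t i : {j | (val y).2 0 j = (val x).2 0 i}.
  apply/cid; have : range ((val y).2 0) ((val x).2 0 i) by rewrite ry -rx; exists i.
  by case=> j _ <-; exists j.
have injt : injective (fun i => sval (ex_t i)).
  by move=> i j E; apply: injx; rewrite -(svalP (ex_t i)) E (svalP (ex_t j)).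
exists (perm injt); apply/andP; split; apply/eqP/rowP => i; rewrite mxE permE.
  by rewrite ex ey (svalP (ex_t i)).
by rewrite (svalP (ex_t i)).
Qed.

(* residue_coords is a bijection, so the initial topology is the topology of
   residue_space transported to Omega1 s. *)
HB.instance Definition _ := Choice.copy (Omega1 s) (set_type (is_Omega1 s)).
HB.instance Definition _ :=
  Topological.copy (Omega1 s) (initial_topology residue_coords).

End Coordinates.

(* PSL(2, C) is the topological quotient of SL(2, C) by A ~ - A. *)
Definition SL2 : set 'M[C]_2 := [set A | \det A = 1].

Definition pm_eqv (A B : SL2) : bool := (val B == val A) || (val B == - val A).

Lemma pm_eqv_refl : reflexive pm_eqv.
Proof. by move=> A; rewrite /pm_eqv eqxx. Qed.

Lemma pm_eqv_sym : symmetric pm_eqv.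
Proof. move=> A B; rewrite /pm_eqv [val A == _]eq_sym.
by congr (_ || _); rewrite -eqr_oppLR eq_sym. Qed.

Lemma pm_eqv_trans : transitive pm_eqv.
Proof.
move=> B A D /orP[]/eqP E /orP[]/eqP E'; rewrite /pm_eqv E' E ?opprK eqxx //.
  by rewrite orbT.
by rewrite orbT.
Qed.

Canonical pm_eqv_equiv := EquivRel pm_eqv pm_eqv_refl pm_eqv_sym pm_eqv_trans.

Definition PSL2 : Type := quotient_topology {eq_quot pm_eqv}.
HB.instance Definition _ :=
  Topological.copy PSL2 (quotient_topology {eq_quot pm_eqv}).

Definition PSL2_class (A : SL2) : PSL2 :=
  \pi_(quotient_topology {eq_quot pm_eqv})%qT A.

Definition PSL2_repr (T : PSL2) : SL2 :=
  repr (T : quotient_topology {eq_quot pm_eqv}).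

Lemma SL2_det (A : SL2) : \det (val A) != 0.
Proof. by rewrite (set_mem (valP A)) oner_neq0. Qed.

Lemma mob_pushforwardM A B w : \det A != 0 -> \det B != 0 ->
  mob_pushforward (A *m B) w = mob_pushforward A (mob_pushforward B w).
Proof.
move=> dA dB; have uA : A \in unitmx by rewrite unitmxE unitfE.
have uB : B \in unitmx by rewrite unitmxE unitfE.
have uAB : A *m B \in unitmx by rewrite unitmx_mul uA.
have E : invmx (A *m B) = invmx B *m invmx A.
  apply: (can_inj (mulKmx uAB)).
  by rewrite mulmxV // mulmxA mulmxK // mulmxV.
by rewrite /mob_pushforward E mob_pullbackM ?det_inv ?invr_eq0.
Qed.

Lemma mob_pullbackN A w : mob_pullback (- A) w = mob_pullback A w.
Proof.
have dN : mob_den (- A) = - mob_den A.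
  by rewrite /mob_den !mxE scaleNr polyCN opprD.
have nN : mob_num (- A) = - mob_num A.
  by rewrite /mob_num !mxE scaleNr polyCN opprD.
rewrite /mob_pullback /mob_fun dN nN !tofracN invrN mulrNN sqrrN.
by rewrite !det2 !mxE !mulrNN.
Qed.

Lemma is_Omega1_pushforward s (A : SL2) w :
  is_Omega1 s w -> is_Omega1 s (mob_pushforward (val A) w).
Proof. by apply: is_Omega1_pullback; rewrite det_inv invr_eq0 SL2_det. Qed.

(* (T, w) |-> T_* w; by Omega1_actE below the value does not depend on the
   representative matrix of T. *)
Definition Omega1_act (s : nat) (T : PSL2) (w : Omega1 s) : Omega1 s :=
  exist _ (mob_pushforward (val (PSL2_repr T)) (val w))
    (mem_set (is_Omega1_pushforward (PSL2_repr T) (set_mem (valP w)))).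

Lemma Omega1_actE s (A : SL2) (w : Omega1 s) :
  val (Omega1_act (PSL2_class A) w) = mob_pushforward (val A) (val w).
Proof.
have /eqmodP/orP[/eqP E|/eqP E] :
    PSL2_class A = PSL2_class (PSL2_repr (PSL2_class A)).
- by rewrite /PSL2_class reprK.
- by rewrite /= E.
- rewrite /= E /mob_pushforward.
  have uA : val A \in unitmx by rewrite unitmxE unitfE SL2_det.
  have uN : - val A \in unitmx by rewrite -scaleN1r unitmxZ ?unitrN1.
  rewrite (_ : invmx (- val A) = - invmx (val A)) ?mob_pullbackN //.
  apply: (can_inj (mulKmx uN)).
  by rewrite mulmxV // mulmxN mulNmx opprK mulmxV.
Qed.

(* all residues are purely imaginary *)
Definition isochronous (s : nat) : set (Omega1 s) :=
  [set w | forall p, poles (val w) p -> 'Re (residue (val w) p) = 0].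

(* with the subspace topology *)
Definition RIOmega1 (s : nat) : Type := set_type (@isochronous s).
HB.instance Definition _ (s : nat) :=
  Topological.copy (RIOmega1 s) (set_type (@isochronous s)).

Lemma isochronous_act s (T : PSL2) (w : Omega1 s) :
  isochronous w -> isochronous (Omega1_act T w).
Proof.
have dT : \det (invmx (val (PSL2_repr T))) != 0 by rewrite det_inv invr_eq0 SL2_det.
move=> iw p /(proj2 (poles_pullback (val w) p dT)) wp /=.
by rewrite -(residue_pullback (val w) p dT); exact: iw.
Qed.

Definition RIOmega1_act (s : nat) (T : PSL2) (w : RIOmega1 s) : RIOmega1 s :=
  exist _ (Omega1_act T (val w)) (mem_set (@isochronous_act s T _ (set_mem (valP w)))).

End RationalForms.

Definition proper_map (X Y : topologicalType) (f : X -> Y) : Prop :=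
  continuous f /\ forall K : set Y, compact K -> compact (f @^-1` K).

Definition proper_action (G M : topologicalType) (act : G -> M -> M) : Prop :=
  proper_map (fun gx : G * M => (act gx.1 gx.2, gx.2)).

(* Main.v *)
Require Import Defs.
From mathcomp Require Import all_boot all_order all_algebra perm.
From mathcomp Require Import fraction complex ring.
From mathcomp Require Import all_classical all_reals topology normedtype.

Set Implicit Arguments.
Unset Strict Implicit.
Unset Printing Implicit Defensive.

Import Order.TTheory GRing.Theory Num.Theory.
Import numFieldNormedType.Exports.

(** The action is proper because a Moebius transformation is controlled by what
    it does to three distinct points, and a form has at least three poles.

    Compactness is tested on ultrafilters.  Let (T, w) run along an ultrafilter
    for which (T_* w, w) stays in a compact set, so that w tends to some w0 and
    T_* w to some w1.  The space of forms is a quotient by the finite group S(s),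
    and an ultrafilter cannot hesitate between finitely many alternatives, so the
    poles and residues of w and of T_* w can be numbered in such a way that each
    of them converges ([ultra_cvg_lists]) and that the two numberings correspond
    to each other under T.  Hence three points p_k tend to distinct limits while
    the points T p_k tend to distinct limits too.

    Represent T by a matrix A of determinant 1 and choose homogeneous vectors
    v_k of p_k and u_k of T p_k that converge to nonzero vectors
    ([lift_at]).  Then A v_k = c_k u_k, and comparing two-dimensional
    determinants gives c_k c_l = (v_k ^ v_l) / (u_k ^ u_l), which converges to a
    nonzero number for k <> l.  From c_k ^ 2 = (c_k c_l) (c_k c_m) / (c_l c_m)
    each c_k is bounded, and A, which is determined by two of the relations
    A v_k = c_k u_k, is bounded as well ([moebius_entries_bounded]).  Bounded
    entries converge along the ultrafilter because closed discs are compact, so A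
    has a limit B, again of determinant 1.  By continuity of the action on poles,
    w1 and B_* w0 have the same poles and residues, hence are equal
    ([lists_residues_inj]).  So (T, w) tends to ([B], w0), whose image is the limit
    (w1, w0) in the compact set ([Omega1_act_proper]).

    The isochronous forms are an invariant subspace with the induced topology,
    and properness passes to such a subspace ([proper_action_restrict]). *)

Local Open Scope classical_set_scope.
Local Open Scope ring_scope.

(** * Convergence along filters and ultrafilters *)

Lemma cvg_mxP (S : Type) (X : topologicalType) m n (F : set_system S)
    (FF : Filter F) (A : S -> 'M[X]_(m, n)) (B : 'M[X]_(m, n)) :
  A @ F --> B <-> forall i j, A t i j @[t --> F] --> B i j.
Proof.
split=> [AB i j N BN|AB N [P BP PN]].
  apply: (AB [set M : 'M[X]_(m, n) | N (M i j)]).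
  exists (fun i' j' => [set x | (i', j') = (i, j) -> N x]) => /=.
    move=> i' j'; have [[-> ->]|ne] := eqVneq (i', j') (i, j).
      by apply: filterS BN => x Nx _.
    by apply: filterE => x E; rewrite E eqxx in ne.
  by move=> M /(_ i j) /=; apply.
rewrite nbhs_simpl /=.
have : F [set t | forall ij : 'I_m * 'I_n, P ij.1 ij.2 (A t ij.1 ij.2)].
  by apply: filter_forall => -[i j]; exact: AB.
by apply: filterS => t Pt; apply: PN => i j; exact: (Pt (i, j)).
Qed.

Lemma cvg_subtypeP (S : Type) (X : topologicalType) (D : set X)
    (F : set_system S) (FF : Filter F) (f : S -> D) (a : D) :
  f @ F --> a <-> (set_val (f t) : X) @[t --> F] --> set_val a.
Proof.
split=> fa N aN.
  exact: (fa _ (@initial_continuous D X set_val a N aN)).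
case: aN => _ [[O oO <-] Oa ON]; rewrite nbhs_simpl /=.
have Oa' : nbhs (set_val a) O by apply: open_nbhs_nbhs; split.
have := fa _ Oa'; rewrite nbhs_simpl /=.
by apply: filterS => t Ot; exact: ON.
Qed.

(** Otherwise the complements of the finitely many alternatives would all belong
    to the ultrafilter, and so would their intersection. *)
Lemma ultra_exists (S : Type) (I : finType) (U : set_system S)
    (UU : UltraFilter U) (P : I -> set S) :
  U [set t | exists i, P i t] -> exists i, U (P i).
Proof.
move=> UP; apply: contrapT => /forallNP nP.
have : U [set t | forall i, ~ P i t].
  apply: filter_forall => i; have [Pi|//] := in_ultra_setVsetC (P i) UU.
  by case: (nP i).
move=> nUP; have [t [[i Pit] nPt]] := filter_ex (filterI UP nUP).
exact: (nPt i).
Qed.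

(** This lifts convergence through a quotient by a finite group: if each f i
    avoided some neighbourhood of a, all of them would avoid the intersection of
    these neighbourhoods. *)
Lemma ultra_cvg_exists (S : Type) (I : finType) (X : topologicalType)
    (U : set_system S) (UU : UltraFilter U) (f : I -> S -> X) (a : X) :
  (forall N, nbhs a N -> U [set t | exists i, N (f i t)]) ->
  exists i, f i @ U --> a.
Proof.
move=> fa; apply: contrapT => /forallNP nf.
have nfN i : exists N, nbhs a N /\ ~ U (f i @^-1` N).
  apply: contrapT => /forallNP H; apply: (nf i) => N aN.
  by apply: contrapT => nU; apply: (H N).
have /choice[N NP] := nfN.
have aN : nbhs a [set x | forall i, N i x].
  by apply: filter_forall => i; exact: (NP i).1.
have [i Ui] := ultra_exists UU (fa _ aN); apply: (NP i).2.
by apply: filterS Ui => t /(_ i).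
Qed.

#[global] Instance fmap_ultra S S' (f : S -> S') (U : set_system S) (UU : UltraFilter U) :
  UltraFilter (f @ U).
Proof.
split=> [|G PG UG]; first exact: fmap_proper_filter.
apply/seteqP; split=> B; last exact: UG.
move=> GB; have [//|UnB] := in_ultra_setVsetC (f @^-1` B) UU.
have /UG GnB : (f @ U) (~` B) by [].
by have [x []] := filter_ex (filterI GB GnB).
Qed.

Section Bounded.
Context {C : numFieldType} {S : Type}.

Definition bounded_along (F : set_system S) (f : S -> C) :=
  exists M : C, \forall t \near F, `|f t| <= M.

Lemma cvg_bounded_along (F : set_system S) (FF : Filter F) (f : S -> C) (l : C) :
  f @ F --> l -> bounded_along F f.
Proof.
move=> /cvgrPdist_le /(_ 1 ltr01) fl; exists (`|l| + 1).
apply: filterS fl => t ft; rewrite -lerBlDl.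
by apply: le_trans ft; rewrite distrC; exact: lerB_dist.
Qed.

Lemma bounded_alongD (F : set_system S) (FF : Filter F) f g :
  bounded_along F f -> bounded_along F g -> bounded_along F (fun t => f t + g t).
Proof.
move=> [M fM] [N gN]; exists (M + N); apply: filterS2 fM gN => t ft gt.
by apply: le_trans (ler_normD _ _) _; exact: lerD.
Qed.

Lemma bounded_alongM (F : set_system S) (FF : Filter F) f g :
  bounded_along F f -> bounded_along F g -> bounded_along F (fun t => f t * g t).
Proof.
move=> [M fM] [N gN]; exists (M * N); apply: filterS2 fM gN => t ft gt.
by rewrite normrM; apply: ler_pM.
Qed.

Lemma bounded_alongN (F : set_system S) (FF : Filter F) f : bounded_along F f -> bounded_along F (fun t => - f t).
Proof. by move=> [M fM]; exists M; apply: filterS fM => t; rewrite normrN. Qed.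

Lemma bounded_along_eq (F : set_system S) (FF : Filter F) f g :
  (\forall t \near F, f t = g t) -> bounded_along F g -> bounded_along F f.
Proof. by move=> fg [M gM]; exists M; apply: filterS2 fg gM => t ->. Qed.

(** |f| <= |f|^2 + 1, whether |f| is below or above 1. *)
Lemma bounded_along_sqr (F : set_system S) (FF : Filter F) f :
  bounded_along F (fun t => f t ^+ 2) -> bounded_along F f.
Proof.
move=> [M fM]; exists (M + 1); apply: filterS fM => t ft.
apply: (@le_trans _ _ (`|f t| ^+ 2 + 1)); last first.
  by rewrite lerD2r -normrX.
have /ger0_real r : 0 <= `|f t| by [].
have [f1|f1] := real_leP r (real1 C).
  by apply: le_trans f1 _; rewrite lerDr exprn_ge0.
rewrite expr2; apply: (@le_trans _ _ (`|f t| * `|f t|)); last by rewrite lerDl.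
by rewrite ler_peMr // ltW.
Qed.

End Bounded.

(** * The sphere in homogeneous coordinates *)

Section Sphere.
Variable C : numClosedFieldType.
Hypothesis disc_compact : forall M : C, compact [set z : C | `|z| <= M].
Local Notation sphere := (sphere C).

Lemma disc_closed (M : C) : closed [set z : C | `|z| <= M].
Proof. by apply: compact_closed; [exact: norm_hausdorff|exact: disc_compact]. Qed.

(** Closed discs are compact, so their complements are neighbourhoods of
    infinity. *)
Lemma near_infty_gt (M : C) :
  \forall p \near (None : sphere), if p is Some a then ~~ (`|a| <= M) else true.
Proof.
exists [set z : C | `|z| <= M]; first by split; [exact: disc_compact|exact: disc_closed].
by move=> _ [[a /= /negP aM <-]|->].
Qed.

Lemma near_Some (a : C) (N : set sphere) :
  (\forall x \near a, N (Some x)) -> nbhs (Some a : sphere) N.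
Proof. by []. Qed.

(** [hvec] is discontinuous at infinity; rescaled to (1, 1 / a) around infinity,
    it becomes a homogeneous vector that is continuous in p near p0.  At a = 0,
    away from infinity, [hvec] serves to keep the vector nonzero. *)
Definition lift_at (p0 p : sphere) : 'cV[C]_2 :=
  match p0, p with
  | None, Some a => if a == 0 then hvec p else a^-1 *: hvec p
  | _, _ => hvec p
  end.

Lemma lift_atP p0 p : exists2 c, c != 0 & lift_at p0 p = c *: hvec p.
Proof.
case: p0 p => [a|] [b|] /=; try by exists 1; rewrite ?scale1r ?oner_neq0.
case: eqVneq => [_|b0]; first by exists 1; rewrite ?scale1r ?oner_neq0.
by exists b^-1; rewrite ?invr_eq0.
Qed.

Lemma hvec0 (p : sphere) : hvec p 0 0 = if p is Some a then a else 1.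
Proof. by case: p => [a|]; rewrite !mxE. Qed.
Lemma hvec1 (p : sphere) : hvec p 1 0 = if p is Some a then 1 else 0.
Proof. by case: p => [a|]; rewrite !mxE. Qed.

Lemma cvg_lift_at (S : Type) (F : set_system S) (FF : Filter F) (p : S -> sphere)
    (p0 : sphere) i :
  p @ F --> p0 -> lift_at p0 (p t) i 0 @[t --> F] --> lift_at p0 p0 i 0.
Proof.
move=> pp0; apply: (cvg_comp (G := nbhs p0) _ (fun q => lift_at p0 q i 0)) => //.
have [->|->] : i = 0 \/ i = 1.
  by case: i => -[|[|//]] li; [left|right]; apply/val_inj.
- case: p0 {pp0} => [a|] /=; rewrite hvec0.
    by move=> N aN; apply: near_Some; apply: filterS aN => x; rewrite /= hvec0.
  apply: cvg_near_cst; apply: filterS (near_infty_gt 0) => -[b|]; last by rewrite hvec0.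
  by case: eqVneq => [->|b0 _]; rewrite ?normr0 ?lexx // !mxE mulVf.
- case: p0 {pp0} => [a|] /=; rewrite hvec1.
    move=> N /nbhs_singleton aN; apply: near_Some; apply: filterE => x.
    by rewrite /= hvec1.
  apply/cvgrPdist_le => e e0; apply: filterS (near_infty_gt e^-1) => -[b|]; last first.
    by rewrite hvec1 subrr normr0 ltW.
  rewrite sub0r normrN; case: eqVneq => [->|b0].
    by rewrite normr0 invr_ge0 ltW.
  rewrite !mxE /= mulr1 normfV -real_ltNge ?realE ?invr_ge0 ?normr_ge0 ?(ltW e0) // => be.
  by rewrite -[e]invrK lef_pV2 ?posrE ?invr_gt0 ?normr_gt0 // ltW.
Qed.

(** The determinant of the pair (u, v): it expresses equality of points of the
    sphere by a continuous equation. *)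
Definition wedge (u v : 'cV[C]_2) : C := u 0 0 * v 1 0 - u 1 0 * v 0 0.

Lemma wedge_hvec (p q : sphere) : wedge (hvec p) (hvec q) = 0 -> p = q.
Proof.
rewrite /wedge !hvec0 !hvec1; case: p q => [a|] [b|]; rewrite ?mul1r ?mulr1 ?mul0r ?mulr0.
- by move/eqP; rewrite subr_eq0 => /eqP ->.
- by move/eqP; rewrite sub0r oppr_eq0 oner_eq0.
- by move/eqP; rewrite subr0 oner_eq0.
- by [].
Qed.

Lemma wedgeZ a b u v : wedge (a *: u) (b *: v) = a * b * wedge u v.
Proof. by rewrite /wedge !mxE; ring. Qed.

Lemma wedgevv u : wedge u u = 0.
Proof. by rewrite /wedge mulrC subrr. Qed.

Lemma wedge_lift_at_inj p0 q0 p q : wedge (lift_at p0 p) (lift_at q0 q) = 0 -> p = q.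
Proof.
have [a a0 ->] := lift_atP p0 p; have [b b0 ->] := lift_atP q0 q.
rewrite wedgeZ => /eqP; rewrite !mulf_eq0 (negPf a0) (negPf b0) /=.
by move=> /eqP /wedge_hvec.
Qed.

Lemma wedge_lift_at_same p0 q0 p : wedge (lift_at p0 p) (lift_at q0 p) = 0.
Proof.
have [a a0 ->] := lift_atP p0 p; have [b b0 ->] := lift_atP q0 p.
by rewrite wedgeZ wedgevv mulr0.
Qed.

Lemma cvg_wedge (S : Type) (F : set_system S) (FF : Filter F) (u v : S -> 'cV[C]_2)
    (u0 v0 : 'cV[C]_2) :
  (forall i, u t i 0 @[t --> F] --> u0 i 0) ->
  (forall i, v t i 0 @[t --> F] --> v0 i 0) ->
  wedge (u t) (v t) @[t --> F] --> wedge u0 v0.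
Proof. by move=> uu vv; apply: cvgB; apply: cvgM. Qed.

(** The wedge of the lifts of one and the same point around p0 and around p1
    vanishes, hence so does its limit. *)
Lemma sphere_cvg_unique (S : Type) (F : set_system S) (FF : ProperFilter F)
    (p : S -> sphere) (p0 p1 : sphere) : p @ F --> p0 -> p @ F --> p1 -> p0 = p1.
Proof.
move=> pp0 pp1; apply: (@wedge_lift_at_inj p0 p1).
apply: (@cvg_unique _ (@norm_hausdorff _ C) (wedge (lift_at p0 (p t)) (lift_at p1 (p t)) @[t --> F])).
  by apply: cvg_wedge => i; exact: cvg_lift_at.
by apply: cvg_near_cst; apply: filterE => t; exact: wedge_lift_at_same.
Qed.

(** The projection from nonzero vectors to the sphere is continuous.  Only the
    limit at infinity needs care: there v1 / v0 tends to 0, so v0 / v1 leaves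
    every compact set K because z * e stays small for z in K and e near 0. *)
Lemma cvg_of_hvec (S : Type) (F : set_system S) (FF : Filter F) (v : S -> 'cV[C]_2) (v0 : 'cV[C]_2) :
  v0 != 0 -> (forall i, v t i 0 @[t --> F] --> v0 i 0) ->
  of_hvec (v t) @[t --> F] --> (of_hvec v0 : sphere).
Proof.
move=> v00 vv; rewrite /of_hvec; case: ifPn => [/eqP v1|v1].
  have v0n : v0 0 0 != 0.
    by apply: contra v00 => /eqP v0E; apply/eqP/cV2P; rewrite !mxE.
  move=> N [K [cK _] KN]; rewrite nbhs_simpl /=.
  (* Compactness of K makes the bound `|z * e| < 1 uniform in z. *)
  have near0 : \forall e \near (0 : C), forall z, K z -> `|z * e| < 1.
    move: cK => /compact_near_coveringP/(_ _ (nbhs (0 : C)) (fun e z => `|z * e| < 1) _).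
    apply=> z Kz.
    have : (zt.1 * zt.2 : C) @[zt --> (z, 0 : C)] --> z * 0 by apply: cvgM; [exact: cvg_fst|exact: cvg_snd].
    rewrite mulr0 => /cvgr0Pnorm_lt /(_ 1 ltr01) H.
    exact: H.
  have e0 : (v t 1 0 / v t 0 0) @[t --> F] --> (0 : C).
    rewrite -(mul0r (v0 0 0)^-1) -v1; apply: cvgM => //.
    by apply: cvgV.
  have v0t : \forall t \near F, v t 0 0 != 0 by apply: (cvgr_neq0 _ (vv 0)).
  have := e0 _ near0; rewrite nbhs_simpl /= => Ft.
  apply: filterS2 v0t Ft => t vt0 Kt; apply: KN.
  case: ifPn => [_|vt1]; [by right|left].
  exists (v t 0 0 / v t 1 0) => // /Kt.
  rewrite mulrA divfK // divff // normr1 ltxx //.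
have v1t : \forall t \near F, v t 1 0 != 0 by apply: (cvgr_neq0 _ (vv 1)).
have q : v t 0 0 / v t 1 0 @[t --> F] --> v0 0 0 / v0 1 0.
  by apply: cvgM => //; exact: cvgV.
move=> N N0; have := q _ N0; rewrite !nbhs_simpl /= => Ft.
by apply: filterS2 v1t Ft => t vt1 /=; rewrite (negPf vt1).
Qed.

Lemma mulmx2E (A : 'M[C]_2) (v : 'cV[C]_2) i : (A *m v) i 0 = A i 0 * v 0 0 + A i 1 * v 1 0.
Proof.
by rewrite mxE big_ord_recl big_ord1; congr (_ + A i _ * v _ 0); exact/val_inj.
Qed.

Lemma moebius_lift (A : 'M[C]_2) p0 p : moebius A p = of_hvec (A *m lift_at p0 p).
Proof.
have [c c0 ->] := lift_atP p0 p.
by rewrite -scalemxAr of_hvecZ.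
Qed.

Lemma mulmx_lift_neq0 (A : 'M[C]_2) p0 p : \det A != 0 -> A *m lift_at p0 p != 0.
Proof.
move=> dA; have [c c0 ->] := lift_atP p0 p.
apply: contra (hvec_neq0 p) => /eqP Ap.
have uA : A \in unitmx by rewrite unitmxE unitfE.
have /eqP := mulKmx uA (c *: hvec p).
by rewrite Ap mulmx0 eq_sym scaler_eq0 (negPf c0).
Qed.

Lemma cvg_moebius (S : Type) (F : set_system S) (FF : Filter F)
    (A : S -> 'M[C]_2) (A0 : 'M[C]_2)
    (p : S -> sphere) (p0 : sphere) : \det A0 != 0 ->
  A @ F --> A0 -> p @ F --> p0 ->
  moebius (A t) (p t) @[t --> F] --> moebius A0 p0.
Proof.
move=> dA /cvg_mxP AA0 pp0.
under eq_fun do rewrite (moebius_lift _ p0).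
rewrite (moebius_lift _ p0); apply: cvg_of_hvec; first exact: mulmx_lift_neq0.
move=> i; under eq_fun do rewrite mulmx2E.
by rewrite mulmx2E; apply: cvgD; apply: cvgM => //; exact: cvg_lift_at.
Qed.

Lemma wedge_mulmx (A : 'M[C]_2) u v : wedge (A *m u) (A *m v) = \det A * wedge u v.
Proof. by rewrite /wedge !mulmx2E det2; ring. Qed.

(** * Boundedness of the matrices *)

Lemma moebius_scale (A : 'M[C]_2) p0 q0 p : \det A != 0 ->
  exists2 c, c != 0 & A *m lift_at p0 p = c *: lift_at q0 (moebius A p).
Proof.
move=> dA; have [c c0 E] := of_hvecK (mulmx_lift_neq0 p0 p dA).
rewrite -moebius_lift in E; have [d d0 E'] := lift_atP q0 (moebius A p).
by exists (c / d); rewrite ?mulf_neq0 ?invr_eq0 // E E' scalerA divfK.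
Qed.

(** Three points whose limits are distinct before and after applying A pin A
    down: the factors c k in A (v k) = c k * u k have convergent pairwise products
    with nonzero limits, hence are bounded, and Cramer's rule recovers A from
    two of these relations. *)
Lemma moebius_entries_bounded (S : Type) (F : set_system S) (FF : Filter F)
    (A : S -> 'M[C]_2) (p : 'I_3 -> S -> sphere) (p0 q0 : 'I_3 -> sphere) :
  (forall t, \det (A t) = 1) -> injective p0 -> injective q0 ->
  (forall k, p k @ F --> p0 k) ->
  (forall k, moebius (A t) (p k t) @[t --> F] --> q0 k) ->
  forall i j, bounded_along F (fun t => A t i j).
Proof.
move=> dA p0I q0I pp qq.
pose v k t := lift_at (p0 k) (p k t).
pose u k t := lift_at (q0 k) (moebius (A t) (p k t)).
have vc k i : v k t i 0 @[t --> F] --> lift_at (p0 k) (p0 k) i 0 by exact: cvg_lift_at.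
have uc k i : u k t i 0 @[t --> F] --> lift_at (q0 k) (q0 k) i 0 by exact: cvg_lift_at.
have cP k : exists c : S -> C, forall t, c t != 0 /\ A t *m v k t = c t *: u k t.
  have H t : exists ct, ct != 0 /\ A t *m v k t = ct *: u k t.
    by apply/exists2P/moebius_scale; rewrite dA oner_neq0.
  by have /choice[c cP] := H; exists c.
have /choice[c cP'] := cP.
have cE k t : A t *m v k t = c k t *: u k t by have [] := cP' k t.
have c0 k t : c k t != 0 by have [] := cP' k t.
have cc k l : k != l -> bounded_along F (fun t => c k t * c l t).
  move=> kl; have W0 : wedge (lift_at (q0 k) (q0 k)) (lift_at (q0 l) (q0 l)) != 0.
    by apply: contra kl => /eqP /wedge_lift_at_inj /q0I ->.
  have Wc := cvg_wedge FF (uc k) (uc l).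
  apply: (@bounded_along_eq _ _ _ _ _ (fun t => wedge (v k t) (v l t) / wedge (u k t) (u l t))).
    apply: filterS (cvgr_neq0 _ Wc W0) => t w0.
    apply: (mulIf w0); rewrite divfK // -[RHS]mul1r -(dA t) -wedge_mulmx !cE.
    by rewrite wedgeZ.
  apply: cvg_bounded_along; apply: cvgM; last exact: (cvgV W0 Wc).
  exact: cvg_wedge (vc k) (vc l).
have cV k l : k != l -> bounded_along F (fun t => (c k t * c l t)^-1).
  move=> kl; have W0 : wedge (lift_at (p0 k) (p0 k)) (lift_at (p0 l) (p0 l)) != 0.
    by apply: contra kl => /eqP /wedge_lift_at_inj /p0I ->.
  have Wc := cvg_wedge FF (vc k) (vc l).
  apply: (@bounded_along_eq _ _ _ _ _ (fun t => wedge (u k t) (u l t) / wedge (v k t) (v l t))).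
    apply: filterS (cvgr_neq0 _ Wc W0) => t w0.
    have E : wedge (v k t) (v l t) = c k t * c l t * wedge (u k t) (u l t).
      by rewrite -[LHS]mul1r -(dA t) -wedge_mulmx !cE wedgeZ.
    move: w0; rewrite E mulf_eq0 negb_or => /andP[w1 w2].
    by field; rewrite w2 !c0.
  apply: cvg_bounded_along; apply: cvgM; last exact: (cvgV W0 Wc).
  exact: cvg_wedge (uc k) (uc l).
have cb k : bounded_along F (c k).
  have [l [m [kl km lm]]] : exists l m, [/\ k != l, k != m & l != m].
    exists (k + 1), (k + 1 + 1); case: k => -[|[|[|//]]] ?; split=> //.
  apply: bounded_along_sqr.
  apply: (@bounded_along_eq _ _ _ _ _ (fun t => (c k t * c l t) * (c k t * c m t) * (c l t * c m t)^-1)).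
    apply: filterE => t; field; by rewrite !c0.
  by apply: bounded_alongM; [apply: bounded_alongM; exact: cc|exact: cV].
have ub k i : bounded_along F (fun t => u k t i 0) by apply: cvg_bounded_along; exact: uc.
have vb k i : bounded_along F (fun t => v k t i 0) by apply: cvg_bounded_along; exact: vc.
have W0 : wedge (lift_at (p0 0) (p0 0)) (lift_at (p0 1) (p0 1)) != 0.
  by apply/eqP => /wedge_lift_at_inj /p0I.
have Wc := cvg_wedge FF (vc 0) (vc 1).
have Wb : bounded_along F (fun t => (wedge (v 0 t) (v 1 t))^-1).
  by apply: cvg_bounded_along; exact: (cvgV W0 Wc).
have row t k i : A t i 0 * v k t 0 0 + A t i 1 * v k t 1 0 = c k t * u k t i 0.
  by rewrite -mulmx2E cE mxE.
have tb k l i j : bounded_along F (fun t => c k t * u k t i 0 * v l t j 0).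
  by apply: bounded_alongM => //; exact: bounded_alongM.
move=> i j; have [->|->] : j = 0 \/ j = 1.
  by case: j => -[|[|//]] lj; [left|right]; apply/val_inj.
(* Cramer's rule for row i of A, with determinant wedge (v 0 t) (v 1 t). *)
- apply: (@bounded_along_eq _ _ _ _ _ (fun t => (c 0 t * u 0 t i 0 * v 1 t 1 0
      + - (c 1 t * u 1 t i 0 * v 0 t 1 0)) * (wedge (v 0 t) (v 1 t))^-1)).
    apply: filterS (cvgr_neq0 _ Wc W0) => t w0; apply: (mulIf w0).
    by rewrite divfK // -!row /wedge; ring.
  by apply: bounded_alongM => //; apply: bounded_alongD => //; exact: bounded_alongN.
- apply: (@bounded_along_eq _ _ _ _ _ (fun t => (c 1 t * u 1 t i 0 * v 0 t 0 0
      + - (c 0 t * u 0 t i 0 * v 1 t 0 0)) * (wedge (v 0 t) (v 1 t))^-1)).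
    apply: filterS (cvgr_neq0 _ Wc W0) => t w0; apply: (mulIf w0).
    by rewrite divfK // -!row /wedge; ring.
  by apply: bounded_alongM => //; apply: bounded_alongD => //; exact: bounded_alongN.
Qed.
End Sphere.

(** * Forms and their lists of residues *)

Section Forms.
Variable C : numClosedFieldType.
Variable s : nat.
Local Notation data := (@residue_data C s).
Local Notation K := {fraction {poly C}}.
Local Notation "p %:F" := (@FracField.tofrac _ p).
Local Open Scope quotient_scope.

Lemma perm_data_subproof (t : 'S_s) (x : data) :
  @residue_data C s (col_perm t (val x).1, col_perm t (val x).2).
Proof.
have [r0 rs pI] := set_mem (valP x); split=> /=.
- by move=> i; rewrite mxE.
- by rewrite -[RHS]rs [RHS](reindex_perm t); apply: eq_bigr => i _; rewrite mxE.
- by move=> i j; rewrite !mxE => /pI /perm_inj.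
Qed.

Definition perm_data t x : data := exist _ (_, _) (mem_set (perm_data_subproof t x)).

Lemma moebius_data_subproof (A : 'M[C]_2) (x : data) : \det A != 0 ->
  @residue_data C s ((val x).1, \row_i moebius A ((val x).2 0 i)).
Proof.
move=> dA; have [r0 rs pI] := set_mem (valP x); split=> //= i j.
by rewrite !mxE => /(can_inj (moebiusK dA)) /pI.
Qed.

Definition moebius_data A (dA : \det A != 0) x : data :=
  exist _ (_, _) (mem_set (moebius_data_subproof x dA)).

Lemma residue_class_eqP (x y : data) :
  residue_class x = residue_class y <-> exists t, y = perm_data t x.
Proof.
split=> [/eqmodP/existsP[t /andP[/eqP E1 /eqP E2]]|[t ->]].
  by exists t; apply/val_inj/injective_projections.
by apply/eqmodP/existsP; exists t; rewrite /= !eqxx.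
Qed.

Lemma lists_residues_related (w : Omega1 C s) (x y : data) :
  lists_residues (val w) x -> lists_residues (val w) y -> exists t, y = perm_data t x.
Proof.
by move=> /residue_coordsE wx /residue_coordsE wy; apply/residue_class_eqP; rewrite -wx -wy.
Qed.

Lemma lists_residues_perm_data (w : rform C) (x : data) t :
  lists_residues w x -> lists_residues w (perm_data t x).
Proof.
move=> [rx ex]; split=> /= [|i]; last by rewrite !mxE.
rewrite -rx; apply/seteqP; split=> p /= [i _ <-].
  by rewrite mxE; exists (t i).
by exists (t^-1 i)%g; rewrite // mxE permKV.
Qed.

Lemma lists_residues_class (w : Omega1 C s) (x : data) :
  residue_class x = residue_coords w -> lists_residues (val w) x.
Proof.
have [y wy] := lists_residues_exists w; rewrite (residue_coordsE wy).
by move=> /esym/residue_class_eqP[t ->]; exact: lists_residues_perm_data.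
Qed.

Lemma lists_residues_pushforward (A : 'M[C]_2) (dA : \det A != 0) w x :
  lists_residues w x -> lists_residues (mob_pushforward A w) (moebius_data dA x).
Proof.
have dV : \det (invmx A) != 0 by rewrite det_inv invr_eq0.
move=> [rx ex]; split=> /= [|i]; last first.
  by rewrite mxE -residue_pullback // moebiusK.
apply/seteqP; split=> p /=.
  move=> [i _ <-]; rewrite mxE; apply: (poles_pullback _ _ dV).1.
  by rewrite moebiusK // -rx; exists i.
move=> /(poles_pullback _ _ dV).2; rewrite -rx => -[i _ E].
by exists i => //; rewrite mxE E moebiusVK.
Qed.

Lemma lists_residues_act (T : PSL2 C) (w : Omega1 C s) (x : data) :
  lists_residues (val w) x ->
  lists_residues (val (Omega1_act T w)) (moebius_data (SL2_det (PSL2_repr T)) x).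
Proof. exact: lists_residues_pushforward. Qed.

Lemma polar_part_lists (w : Omega1 C s) (x : data) i :
  lists_residues (val w) x -> polar_part (val w) ((val x).2 0 i) ((val x).1 0 i).
Proof.
move=> [rx ->]; have [_ sw] := set_mem (valP w).
have [_ [r wr]] : simple_pole (val w) ((val x).2 0 i) by apply: sw; rewrite -rx; exists i.
by rewrite (residueE wr).
Qed.

Let fX0 : 'X%:F != 0 :> K. Proof. by rewrite tofrac_eq0 polyX_eq0. Qed.

(** Without finite poles the form is P(z) dz for a polynomial P; in the
    coordinate t = 1 / z this is - P(1 / t) / t ^ 2 dt, regular at 0 only for
    P = 0. *)
Lemma rform_eq0 (g : rform C) : (forall p, polar_part g p 0) -> g = 0.
Proof.
move=> g0; have [P gP] : exists P, g = P%:F.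
  by apply: poly_of_regular => a; apply/polar_part0.
have nX := @nonconst_inf C.
have := (polar_part0 g None).1 (g0 None).
rewrite local_inf gP rcomp_poly // => /regular0N; rewrite opprK => reg.
have [c Pc] : exists c, P = c%:P.
  apply: regular_inf_const.
  rewrite -[X in regular0 X](divfK (expf_neq0 2 fX0)).
  by apply: regular0M => //; rewrite -tofracXn; exact: regular0_poly.
suff -> : P = 0 by rewrite tofrac0.
rewrite Pc; congr (_%:P); apply: regular0_simple.
have -> : rconst c / 'X%:F = rconst c / 'X%:F ^+ 2 * 'X%:F.
  by rewrite expr2 invfM mulrA divfK.
by apply: regular0M; [rewrite Pc pevalC in reg|exact: regular0_poly].
Qed.

(** Two forms with the same simple poles and the same residues differ by a form
    without poles. *)
Lemma lists_residues_inj (w w' : Omega1 C s) (x : data) :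
  lists_residues (val w) x -> lists_residues (val w') x -> w = w'.
Proof.
move=> wx wx'; apply/val_inj/eqP; rewrite -subr_eq0; apply/eqP.
apply: rform_eq0 => p; have [[i _ <-]|np] := pselect (range ((val x).2 0) p).
  by rewrite -(subrr ((val x).1 0 i)); apply: polar_partB; exact: polar_part_lists.
have nonpole (v : Omega1 C s) : lists_residues (val v) x -> polar_part (val v) p 0.
  by move=> [rx _]; apply/polar_part0; apply: contrapT => vp; apply: np; rewrite rx.
by have := polar_partB (nonpole _ wx) (nonpole _ wx'); rewrite subr0.
Qed.

(** * Topology of the space of forms *)

Lemma cvg_dataP S (F : set_system S) (FF : Filter F) (x : S -> data) (x0 : data) :
  x @ F --> x0 <->
  (forall i, (val (x t)).1 0 i @[t --> F] --> (val x0).1 0 i) /\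
  (forall i, (val (x t)).2 0 i @[t --> F] --> (val x0).2 0 i).
Proof.
rewrite cvg_subtypeP; split=> [xx|[x1 x2]].
  have x1 : (val (x t)).1 @[t --> F] --> (val x0).1.
    by apply: (cvg_comp _ fst xx); exact: cvg_fst.
  have x2 : (val (x t)).2 @[t --> F] --> (val x0).2.
    by apply: (cvg_comp _ snd xx); exact: cvg_snd.
  by split=> i; [move/cvg_mxP: x1|move/cvg_mxP: x2]; exact.
have -> : (fun t => set_val (x t)) = (fun t => ((val (x t)).1, (val (x t)).2)).
  by apply/funext => t; exact: surjective_pairing.
have h1 : (val (x t)).1 @[t --> F] --> (val x0).1.
  by apply/cvg_mxP => i j; rewrite (ord1 i).
have h2 : (val (x t)).2 @[t --> F] --> (val x0).2.
  by apply/cvg_mxP => i j; rewrite (ord1 i).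
by rewrite [set_val x0]surjective_pairing; exact: cvg_pair h1 h2.
Qed.

Lemma perm_data_continuous t : continuous (perm_data t).
Proof.
move=> x; apply/(cvg_dataP (nbhs_filter x)).
have [x1 x2] := (cvg_dataP (nbhs_filter x) id x).1 (@cvg_id _ _).
split=> i; rewrite mxE.
  by under eq_fun do rewrite mxE; exact: x1.
by under eq_fun do rewrite mxE; exact: x2.
Qed.

(** The quotient map by the finite group S(s) is open: the saturation of an open
    set is the union of its translates. *)
Lemma nbhs_residue_class (x : data) N : nbhs x N ->
  nbhs (residue_class x) [set q | exists2 x', N x' & residue_class x' = q].
Proof.
rewrite nbhsE => -[O [oO Ox] ON].
apply: (@filterS _ _ _ [set q | exists2 x', O x' & residue_class x' = q]).
  by move=> q [x' /ON]; exists x'.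
apply: open_nbhs_nbhs; split; last by exists x.
rewrite /open /= /quotient_open.
have -> : \pi_(quotient_topology {eq_quot @perm_eqv C s}) @^-1`
    [set q | exists2 x', O x' & residue_class x' = q] =
    \bigcup_(t in setT) (perm_data t @^-1` O).
  apply/seteqP; split=> y /=.
    move=> [x' Ox' /esym/residue_class_eqP[t E]]; exists t => //=.
    by rewrite -E.
  by move=> [t _ /= Oty]; exists (perm_data t y) => //; apply/esym/residue_class_eqP; exists t.
by apply: bigcup_open => t _; apply: open_comp => // y _; exact: perm_data_continuous.
Qed.

(** Openness of the quotient map, read on forms. *)
Lemma nbhs_lists (w : Omega1 C s) (x : data) N :
  lists_residues (val w) x -> nbhs x N ->
  nbhs w [set w' : Omega1 C s | exists2 x', N x' & lists_residues (val w') x'].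
Proof.
move=> wx /nbhs_residue_class; rewrite -(residue_coordsE wx); set V := (X in nbhs _ X) => Nx.
have : nbhs w (@residue_coords C s @^-1` V).
  exact: (@initial_continuous _ _ (@residue_coords C s) w _ Nx).
apply: filterS => w' /= [x' Nx' E].
by exists x' => //; exact: lists_residues_class.
Qed.

(** Continuity of the quotient map, read on forms. *)
Lemma nbhs_listed (w : Omega1 C s) (x : data) W :
  lists_residues (val w) x -> nbhs w W ->
  nbhs x [set x' | forall w' : Omega1 C s, lists_residues (val w') x' -> W w'].
Proof.
move=> wx [_ [[O oO <-] /= Ow OW]].
apply: (@filterS _ _ _ (@residue_class C s @^-1` O)).
  by move=> x' /= Ox' w' /residue_coordsE E; apply: OW; rewrite /= E.
apply: open_nbhs_nbhs; split; last by rewrite /= -(residue_coordsE wx).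
by move: oO; rewrite /open /= /quotient_open.
Qed.

(** Start from arbitrary lists of the f t; every neighbourhood of x contains a
    renumbering of almost all of them, and one renumbering serves almost
    always. *)
Lemma ultra_cvg_lists S (U : set_system S) (UU : UltraFilter U)
    (f : S -> Omega1 C s) (w : Omega1 C s) (x : data) :
  lists_residues (val w) x -> f @ U --> w ->
  exists z : S -> data, (forall t, lists_residues (val (f t)) (z t)) /\ z @ U --> x.
Proof.
move=> wx fw; have /choice[y fy] := fun t => lists_residues_exists (f t).
have [e ex] : exists e, perm_data e (y t) @[t --> U] --> x.
  apply: (@ultra_cvg_exists S _ _ U UU (fun e t => perm_data e (y t))) => N xN.
  have := fw _ (nbhs_lists wx xN); rewrite nbhs_simpl /=.
  apply: filterS => t [x' Nx' fx'].
  by have [e E] := lists_residues_related (fy t) fx'; exists e; rewrite -E.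
exists (fun t => perm_data e (y t)); split=> // t.
exact: lists_residues_perm_data.
Qed.

(** * Topology of PSL(2, C) *)

Lemma SL2_opp_subproof (A : @SL2 C) : @SL2 C (- val A).
Proof.
by have := set_mem (valP A); rewrite /SL2 /= !det2 !mxE !mulrNN.
Qed.
Definition SL2_opp (A : @SL2 C) : @SL2 C := exist _ (- val A) (mem_set (SL2_opp_subproof A)).

Lemma SL2_opp_continuous : continuous SL2_opp.
Proof.
move=> A; apply/(cvg_subtypeP (nbhs_filter A))/(cvg_mxP (nbhs_filter A)) => i j.
have /cvg_mxP AA := (cvg_subtypeP (nbhs_filter A) id A).1 (@cvg_id _ _).
rewrite mxE; under eq_fun do rewrite mxE; apply: cvgN; exact: AA.
Qed.

Lemma PSL2_class_eqP (A B : @SL2 C) :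
  PSL2_class A = PSL2_class B <-> B = A \/ B = SL2_opp A.
Proof.
split=> [/eqmodP/orP[/eqP E|/eqP E]|E]; [left|right|]; try exact/val_inj.
by apply/eqmodP/orP; case: E => ->; [left|right].
Qed.

(** The quotient map from SL(2, C) is open, again because the group, here of
    order two, acts by homeomorphisms. *)
Lemma nbhs_PSL2_class (A : @SL2 C) N : nbhs A N ->
  nbhs (PSL2_class A) [set T | exists2 B, N B & PSL2_class B = T].
Proof.
rewrite nbhsE => -[O [oO OA] ON].
apply: (@filterS _ _ _ [set T | exists2 B, O B & PSL2_class B = T]).
  by move=> q [x' /ON]; exists x'.
apply: open_nbhs_nbhs; split; last by exists A.
rewrite /open /= /quotient_open.
have -> : \pi_(quotient_topology {eq_quot @pm_eqv C}) @^-1`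
    [set T | exists2 B, O B & PSL2_class B = T] = O `|` (SL2_opp @^-1` O).
  apply/seteqP; split=> B /=.
    by move=> [A' OA' /esym/PSL2_class_eqP[E|E]]; [left|right]; rewrite /= -E.
  case=> OB; first by exists B.
  by exists (SL2_opp B) => //; apply/esym/PSL2_class_eqP; right.
by apply: openU => //; apply: open_comp => // B _; exact: SL2_opp_continuous.
Qed.

Lemma PSL2_class_continuous : continuous (@PSL2_class C).
Proof. exact: pi_continuous. Qed.

Lemma PSL2_reprK (T : PSL2 C) : PSL2_class (PSL2_repr T) = T.
Proof. by rewrite /PSL2_class /PSL2_repr reprK. Qed.

Lemma Omega1_act_lists (A : @SL2 C) (w : Omega1 C s) (x : data) :
  lists_residues (val w) x ->
  lists_residues (val (Omega1_act (PSL2_class A) w)) (moebius_data (SL2_det A) x).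
Proof. by move=> wx; rewrite Omega1_actE; exact: lists_residues_pushforward. Qed.

(** * Continuity and properness on the space of forms *)

Hypothesis disc_compact : forall M : C, compact [set z : C | `|z| <= M].

Lemma cvg_moebius_data S (F : set_system S) (FF : Filter F) (A : S -> @SL2 C)
    (B : @SL2 C) (x : S -> data) x0 :
  A @ F --> B -> x @ F --> x0 ->
  moebius_data (SL2_det (A t)) (x t) @[t --> F] --> moebius_data (SL2_det B) x0.
Proof.
move=> /cvg_subtypeP AB /cvg_dataP[x1 x2]; apply/cvg_dataP; split=> //= i.
under eq_fun do rewrite mxE.
by rewrite mxE; apply: cvg_moebius => //; exact: SL2_det.
Qed.

(** The action on matrices and lists is continuous, and continuity descends to the
    quotients because both quotient maps are open: the product of the images of
    two neighbourhoods is a neighbourhood. *)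
Lemma Omega1_act_continuous :
  continuous (fun g : PSL2 C * Omega1 C s => Omega1_act g.1 g.2).
Proof.
move=> [T w] W; rewrite -(PSL2_reprK T) => TwW.
set A := PSL2_repr T in TwW *.
have [x wx] := lists_residues_exists w.
have := nbhs_listed (Omega1_act_lists A wx) TwW; set V := (X in nbhs _ X) => nV.
have /(_ _ nV) : moebius_data (SL2_det p.1) p.2 @[p --> (A, x)] --> moebius_data (SL2_det A) x.
  by apply: cvg_moebius_data; [exact: cvg_fst|exact: cvg_snd].
rewrite nbhs_simpl /= => -[[N1 N2] [/= AN1 xN2] NV].
exists ([set T' | exists2 B, N1 B & PSL2_class B = T'],
  [set w' : Omega1 C s | exists2 x', N2 x' & lists_residues (val w') x']).
  by split=> /=; [exact: nbhs_PSL2_class|exact: nbhs_lists wx xN2].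
move=> [T' w'] [/= [B NB <-] [x' Nx' wx']].
apply: (NV (B, x')) => //.
exact: Omega1_act_lists.
Qed.

Lemma ultra_bounded_cvg S (U : set_system S) (UU : UltraFilter U) (f : S -> C) :
  bounded_along U f -> exists l : C, f @ U --> l.
Proof.
move=> [M fM]; have := @disc_compact M; rewrite compact_ultra => cM.
by have [l [_ fl]] := cM _ (fmap_ultra f UU) fM; exists l.
Qed.

Lemma ultra_SL2_cvg S (U : set_system S) (UU : UltraFilter U) (A : S -> @SL2 C) :
  (forall i j, bounded_along U (fun t => val (A t) i j)) -> exists B : @SL2 C, A @ U --> B.
Proof.
move=> bA.
have H i : exists l : 'I_2 -> C, forall j, val (A t) i j @[t --> U] --> l j.
  have /choice[l lP] := fun j => ultra_bounded_cvg UU (bA i j).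
  by exists l.
have /choice[l lP] := H.
pose B : 'M[C]_2 := \matrix_(i, j) l i j.
have AB i j : val (A t) i j @[t --> U] --> B i j by rewrite mxE.
have dB : @SL2 C B.
  rewrite /SL2 /=.
  apply: (@cvg_unique _ (@norm_hausdorff _ C) (\det (val (A t)) @[t --> U])).
    rewrite /= det2; under eq_fun do rewrite det2.
    by apply: cvgB; apply: cvgM.
  by apply: cvg_near_cst; apply: filterE => t; exact: set_mem (valP (A t)).
exists (exist _ B (mem_set dB)).
by apply/cvg_subtypeP/cvg_mxP.
Qed.

Lemma data_cvg_unique S (F : set_system S) (FF : ProperFilter F) (x : S -> data) (y z : data) :
  x @ F --> y -> x @ F --> z -> y = z.
Proof.
move=> /cvg_dataP[y1 y2] /cvg_dataP[z1 z2].
apply/val_inj/injective_projections; apply/rowP => i.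
  exact: (cvg_unique (@norm_hausdorff _ C) (y1 i) (z1 i)).
exact: (sphere_cvg_unique disc_compact FF (y2 i) (z2 i)).
Qed.

(** The representative matrices of T, although chosen arbitrarily in each class
    {A, - A}, converge along the ultrafilter: they are bounded, and an ultrafilter
    settles on one of the two signs. *)
Lemma Omega1_act_proper : (3 <= s)%N -> proper_action (@Omega1_act C s).
Proof.
move=> hs; split.
  move=> g; have a2 : t.2 @[t --> g] --> g.2 by case: g => T w; exact: cvg_snd.
  exact: cvg_pair (@Omega1_act_continuous g) a2.
move=> K; rewrite !compact_ultra => cK U UU UK.
have [[w' w] [Kww gU]] := cK _ (fmap_ultra _ UU) UK.
have cw' : Omega1_act t.1 t.2 @[t --> U] --> w'.
  by apply: (cvg_comp _ fst gU); exact: (@cvg_fst _ _ (nbhs w')).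
have cw : t.2 @[t --> U] --> w by apply: (cvg_comp _ snd gU); exact: (@cvg_snd _ _ (nbhs w')).
have [x0 wx0] := lists_residues_exists w.
have [y0 wy0] := lists_residues_exists w'.
have [x [wx xx0]] := ultra_cvg_lists UU wx0 cw.
have [y [wy yy0]] := ultra_cvg_lists UU wy0 cw'.
pose A (t : PSL2 C * Omega1 C s) := PSL2_repr t.1.
pose z t := moebius_data (SL2_det (A t)) (x t).
(* The list of w moved by T and the converging list of T_* w differ by a
   permutation, which is constant almost everywhere. *)
have [e Ue] : exists e, U [set t | perm_data e (y t) = z t].
  apply: (@ultra_exists _ _ U UU (fun e => [set t | perm_data e (y t) = z t])).
  apply: filterE => t.
  have [e E] := lists_residues_related (wy t) (lists_residues_act t.1 (wx t)).
  by exists e.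
have zy : z @ U --> perm_data e y0.
  have py0 : perm_data e (y t) @[t --> U] --> perm_data e y0.
    by apply: (cvg_comp _ (perm_data e) yy0); exact: perm_data_continuous.
  apply: cvg_trans py0; exact: near_eq_cvg.
have [B AB] : exists B : @SL2 C, A @ U --> B.
  apply: ultra_SL2_cvg.
  pose k (i : 'I_3) := widen_ord hs i.
  have kI : injective k by move=> i j /(congr1 val) E; exact/val_inj.
  have [_ _ xI] := set_mem (valP x0).
  have [_ _ yI] := set_mem (valP (perm_data e y0)).
  have /cvg_dataP[_ x2] := xx0; have /cvg_dataP[_ z2] := zy.
  apply: (@moebius_entries_bounded _ disc_compact _ U _ (fun t => val (A t))
    (fun i t => (val (x t)).2 0 (k i)) (fun i => (val x0).2 0 (k i))
    (fun i => (val (perm_data e y0)).2 0 (k i))).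
  - by move=> t; exact: set_mem (valP (A t)).
  - exact: inj_comp xI kI.
  - exact: inj_comp yI kI.
  - by move=> i; exact: x2.
  - move=> i; have := z2 (k i); under eq_fun do rewrite /= mxE; exact.
have zB : z @ U --> moebius_data (SL2_det B) x0 by exact: cvg_moebius_data.
have E : Omega1_act (PSL2_class B) w = w'.
  apply: (@lists_residues_inj _ _ (perm_data e y0)); last exact: lists_residues_perm_data.
  rewrite (data_cvg_unique _ zy zB); exact: Omega1_act_lists.
exists (PSL2_class B, w); split; first by rewrite /= E.
have TB : t.1 @[t --> U] --> PSL2_class B.
  have -> : (fun t : PSL2 C * Omega1 C s => t.1) = @PSL2_class C \o A.
    by apply/funext => t; rewrite /= PSL2_reprK.
  by apply: (cvg_comp _ (@PSL2_class C) AB); exact: PSL2_class_continuous.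
move=> N Nw; have : U [set t | N (t.1, t.2)] by exact: (cvg_pair TB cw Nw).
by apply: filterS => -[].
Qed.

End Forms.

(** * Restriction to an invariant subspace *)

Section Restriction.
Variables (G M : topologicalType) (D : set M).
Variables (act : G -> M -> M) (actD : G -> D -> D).
Hypothesis actDE : forall g x, set_val (actD g x) = act g (set_val x).

(** A limit found in M lies in D because the second component of an element of
    the compact set is a point of D. *)
Lemma proper_action_restrict : proper_action act -> proper_action actD.
Proof.
move=> [ca pa]; split.
  move=> [g x]; set p := (g, x).
  have p1 : t.1 @[t --> p] --> g by exact: cvg_fst.
  have p2 : t.2 @[t --> p] --> x by exact: cvg_snd.
  have p2' := (cvg_subtypeP (nbhs_filter p) _ _).1 p2.
  have pp : (t.1, set_val t.2) @[t --> p] --> (g, set_val x) by exact: cvg_pair p1 p2'.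
  have pq := cvg_comp _ _ pp (ca (g, set_val x)).
  have pr : act t.1 (set_val t.2) @[t --> p] --> act g (set_val x).
    by apply: (cvg_comp _ fst pq); exact: cvg_fst.
  have ps : actD t.1 t.2 @[t --> p] --> actD g x.
    apply/(cvg_subtypeP (nbhs_filter p)); rewrite actDE.
    by under eq_fun do rewrite actDE.
  exact: cvg_pair ps p2.
move=> K cK; rewrite compact_ultra => U UU UK.
pose h (t : G * D) := (t.1, set_val t.2).
pose K' := [set (set_val x.1, set_val x.2) | x in K].
have cK' : compact K'.
  apply: continuous_compact => //; apply: continuous_subspaceT => -[x y].
  have x1 : set_val t.1 @[t --> (x, y)] --> set_val x.
    by apply/(cvg_subtypeP (nbhs_filter (x, y))); exact: cvg_fst.
  have y1 : set_val t.2 @[t --> (x, y)] --> set_val y.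
    by apply/(cvg_subtypeP (nbhs_filter (x, y))); exact: cvg_snd.
  exact: cvg_pair x1 y1.
have := pa _ cK'; rewrite compact_ultra => cP.
have UP : U [set t | K' (act (h t).1 (h t).2, (h t).2)].
  apply: filterS UK => t Kt.
  by exists (actD t.1 t.2, t.2) => //=; rewrite actDE.
have [[g m] [[[d' d] Kd /= [E1 E2]] hU]] := cP _ (fmap_ultra h UU) UP.
subst m.
exists (g, d); split.
  rewrite /= (_ : actD g d = d') //.
  by apply/val_inj; rewrite [LHS]actDE -E1.
have t1 : t.1 @[t --> U] --> g by apply: (cvg_comp _ fst hU); exact: (@cvg_fst _ _ (nbhs g)).
have t2 : t.2 @[t --> U] --> d.
  apply/cvg_subtypeP; apply: (cvg_comp _ snd hU); exact: (@cvg_snd _ _ (nbhs g)).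
move=> N Nn; have : U [set t | N (t.1, t.2)] by exact: (cvg_pair t1 t2 Nn).
by apply: filterS => -[].
Qed.
End Restriction.

(** * Closed discs of the complex plane *)

Section ComplexDiscs.
Variable R : realType.
Local Open Scope complex_scope.
Local Notation C := (R[i] : numClosedFieldType).

Lemma normc_ge_Re (z : R[i]) : `|complex.Re z|%:C <= `|z|.
Proof.
rewrite normc_def lecR -sqrtr_sqr ler_sqrt ?addr_ge0 ?sqr_ge0 //.
by rewrite lerDl sqr_ge0.
Qed.

Lemma normc_ge_Im (z : R[i]) : `|complex.Im z|%:C <= `|z|.
Proof.
rewrite normc_def lecR -sqrtr_sqr ler_sqrt ?addr_ge0 ?sqr_ge0 //.
by rewrite lerDr sqr_ge0.
Qed.

Lemma real_complex_continuous : continuous (fun x : R => x%:C : C).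
Proof.
move=> a; apply/cvgrPdist_le => e e0.
have [k ek] := complex_realP _ (gtr0_real e0); rewrite ek ltcR in e0 *.
have /cvgrPdist_le /(_ k e0) : id @ nbhs a --> a by exact: cvg_id.
apply: filterS => x ax; rewrite -rmorphB normc_def /= expr0n addr0 sqrtr_sqr.
by rewrite lecR.
Qed.

(** The real and imaginary parts of a bounded ultrafilter converge by compactness
    of real segments. *)
Lemma compact_disc (M : C) : compact [set z : C | `|z| <= M].
Proof.
rewrite compact_ultra => U UU UM.
have [z0 /= z0M] := filter_ex UM.
have [m Em] := complex_realP _ (ger0_real (le_trans (normr_ge0 _) z0M)).
rewrite Em in UM *.
have cvgR (f : C -> R) : (forall z, `|f z|%:C <= `|z|) -> exists a : R, f @ U --> a.
  move=> fz; have := @segment_compact R (- m) m; rewrite compact_ultra => cm.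
  have fm : U [set z | `[- m, m]%classic (f z)].
    apply: filterS UM => z /= zm; rewrite in_itv /= -ler_norml -lecR.
    exact: le_trans (fz z) zm.
  by have [a [_ fa]] := cm _ (fmap_ultra f UU) fm; exists a.
have [a Ra] := cvgR _ normc_ge_Re.
have [b Ib] := cvgR _ normc_ge_Im.
have Uab : U --> (a%:C + 'i * b%:C : C).
  have E : id = (fun z : C => (complex.Re z)%:C + 'i * (complex.Im z)%:C :> C).
    by apply/funext => z; exact: complexE.
  suff : (id : C -> C) @ U --> (a%:C + 'i * b%:C : C) by [].
  rewrite E.
  apply: cvgD; first by apply: (cvg_comp _ _ Ra); exact: real_complex_continuous.
  apply: cvgM; first exact: cvg_cst.
  by apply: (cvg_comp _ _ Ib); exact: real_complex_continuous.
exists (a%:C + 'i * b%:C); split => //=.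
(* The disc is closed: points of it that tend to a limit l outside would come
   closer to l than `|l| - m. *)
have [//|lm] := real_leP (normr_real (a%:C + 'i * b%:C : C)) (introT (complex_realP _) (ex_intro _ m erefl)).
move: lm; rewrite -subr_gt0 => lm.
have /cvgrPdist_lt /(_ _ lm) Ul := Uab.
have [z [/= zl zm]] := filter_ex (filterI Ul UM).
suff : m%:C < m%:C by rewrite ltxx.
apply: lt_le_trans zm; rewrite -(ltrD2l (`|a%:C + 'i * b%:C - z|)).
apply: (lt_le_trans (y := `|a%:C + 'i * b%:C|)).
  by rewrite -ltrBrDr.
by apply: le_trans (ler_normD _ _); rewrite subrK.
Qed.
End ComplexDiscs.

(** * Properness of both actions *)

Theorem lemma3p2 (R : realType) (s : nat) (hs : (3 <= s)%N) :
  proper_action (@Omega1_act R[i] s) /\ proper_action (@RIOmega1_act R[i] s).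
Proof.
have pA := Omega1_act_proper (@compact_disc R) hs.
split=> //; exact: (proper_action_restrict _ pA).
Qed.
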